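(* Let the setting be as described in the context: $X=\{X_s\}_{s\in S}$ and $Y=\{Y_t\}_{t\in T}$ are Markov (or sub-Markov) processes satisfying Assumption (A) of the context, with associated $\mu,\nu,\mathcal F,\phi,\psi,h_s,j_t$. Let $n\ge 1$, $s_0,\dots,s_n\in S$ and $t_0,\dots,t_n\in T$ be such that $s_0<s_1<\dots<s_n$ and $t_0<t_1<\dots<t_n$, and write $\Delta s_k=s_{k+1}-s_k$, $\Delta t_k=t_{k+1}-t_k$. Assume that $f:\mathcal X\to\mathbb C$ and $g:\mathcal Y\to\mathbb C$ are functions such that $h_{s_n}f\in L^2(\mathcal X,\mu)$ and $$j_{t_n}\,g=\mathcal F(h_{s_n}f).$$ Denote $$\mathsf F(x):=\mathbb E\Big[e^{-\sum_{k=0}^{n-1}\Delta t_k\,\psi(X_{s_k})}f(X_{s_n})\,\Big|\,X_{s_0}=x\Big],\quad x\in\mathcal X,$$ $$\mathsf G(y):=\mathbb E\Big[e^{-\sum_{k=0}^{n-1}\Delta s_k\,\phi(Y_{t_{k+1}})}g(Y_{t_n})\,\Big|\,Y_{t_0}=y\Big],\quad y\in\mathcal Y.$$ Then $h_{s_0}\mathsf F\in L^2(\mathcal X,\mu)$ and $$j_{t_0}\mathsf G=\mathcal F(h_{s_0}\mathsf F)\in L^2(\mathcal Y,\nu).$$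
   Context: Setting. $S$ and $T$ are real intervals of the form $[0,b]$ ($b>0$) or $[0,\infty)$. $X=\{X_s\}_{s\in S}$ and $Y=\{Y_t\}_{t\in T}$ are Markov (or sub-Markov) processes with càdlàg paths, with values in $\mathcal X\subseteq\mathbb R$ and $\mathcal Y\subseteq\mathbb R$ respectively; each of $\mathcal X,\mathcal Y$ is an interval (possibly infinite or semi-infinite) or a countable set. Their (possibly sub-Markov, possibly time-inhomogeneous) semigroups are $$\mathcal P_{s_1,s_2}f(x)=\mathbb E[f(X_{s_2})\mid X_{s_1}=x],\qquad \mathcal Q_{t_1,t_2}g(y)=\mathbb E[g(Y_{t_2})\mid Y_{t_1}=y],$$ for bounded Borel measurable $f,g$ and $s_1<s_2$ in $S$, $t_1<t_2$ in $T$. (For sub-Markov processes, functionals are taken to be zero if the process has been killed.) Assumption (A). There exist: (i) two Hilbert spaces $L^2(\mathcal X,\mu)$, $L^2(\mathcal Y,\nu)$ of complex-valued functions and a unitary operator $\mathcal F:L^2(\mathcal X,\mu)\to L^2(\mathcal Y,\nu)$; (ii) continuous functions $\phi:\mathcal Y\to\mathbb C^+$ and $\psi:\mathcal X\to\mathbb C^+$, where $\mathbb C^+=\{z\in\mathbb C:\mathrm{Re}(z)\ge0\}$; (iii) measurable functions $h_s:\mathcal X\to(0,\infty)$, $s\in S$, and $j_t:\mathcal Y\to(0,\infty)$, $t\in T$; such that $$\mathcal P_{s_1,s_2}f(x)=\Big[\tfrac1{h_{s_1}}\mathcal F^{-1}e^{(s_1-s_2)\phi}\mathcal F(h_{s_2}f)\Big](x),\quad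 s_1<s_2,\ s_i\in S,$$ $$\mathcal Q_{t_1,t_2}g(y)=\Big[\tfrac1{j_{t_1}}\mathcal F e^{(t_1-t_2)\psi}\mathcal F^{-1}(j_{t_2}g)\Big](y),\quad t_1<t_2,\ t_i\in T,$$ for all bounded Borel measurable $f\in L^2(\mathcal X,(h_{s_2})^2\mu)$ and $g\in L^2(\mathcal Y,(j_{t_2})^2\nu)$. Here $e^{(s_1-s_2)\phi}$ and $e^{(t_1-t_2)\psi}$ denote multiplication operators. Convention on expectations. If $\xi$ is a bounded functional of the path $\{X_s\}_{s_1\le s\le s_2}$ and $f\in L^2(\mathcal X,(h_{s_2})^2\mu)$, the function $x\mapsto\mathbb E[\xi f(X_{s_2})\mid X_{s_1}=x]$ is understood as the value at $f$ of the unique continuous extension, from bounded functions in $L^2(\mathcal X,(h_{s_2})^2\mu)$ to all of that space, of the operator $f\mapsto\mathbb E[\xi f(X_{s_2})\mid X_{s_1}=\cdot]$ into $L^2(\mathcal X,(h_{s_1})^2\mu)$ (concretely, the $L^2(\mathcal X,(h_{s_1})^2\mu)$-limit obtained with $f_m=f\mathbf 1_{\{|f|\le m\}}$, $m\to\infty$). The same convention applies to $Y$, with $(j_t)^2\nu$ in place of $(h_s)^2\mu$. Equalities are between elements of $L^2$ spaces. *)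

(* Defs.v *)
From HB Require Import structures.
From mathcomp Require Import all_boot all_order all_algebra.
From mathcomp Require Import complex.
From mathcomp Require Import all_classical all_reals all_analysis.
From mathcomp Require Import measurable_realfun.
Set Implicit Arguments.
Unset Strict Implicit.
Unset Printing Implicit Defensive.
Import Order.TTheory GRing.Theory Num.Theory numFieldNormedType.Exports.
Import ComplexField.Normc.
Local Open Scope classical_set_scope.
Local Open Scope ring_scope.
Local Open Scope complex_scope.

Section Complex.
Context {R : realType}.

Definition cexp (z : R[i]) : R[i] :=
  (expR (complex.Re z) * cos (complex.Im z)) +i* (expR (complex.Re z) * sin (complex.Im z)).

(* [R[i]] has no default topology in the library; this is the one of its
   modulus, through the [numFieldType] structure. *)
Definition ccontinuous_on (D : set R) (f : R -> (R[i] : numFieldType)) : Prop :=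
  {within D, continuous f}.

Definition cmeasurable_fun (D : set R) (f : R -> R[i]) : Prop :=
  measurable_fun D (fun x => complex.Re (f x)) /\
  measurable_fun D (fun x => complex.Im (f x)).

Definition cbounded_on (D : set R) (f : R -> R[i]) : Prop :=
  exists M : R, forall x, D x -> normc (f x) <= M.

Definition cintegral d (T : measurableType d) (m : {measure set T -> \bar R})
    (A : set T) (f : T -> R[i]) : R[i] :=
  Rintegral m A (fun x => complex.Re (f x)) +i* Rintegral m A (fun x => complex.Im (f x)).

End Complex.

(* A function on a Borel set [D] of reals is a total function on [R] of which
   only the values on [D] matter, and a measure on [D] is a Borel measure on
   [R] of which only the restriction to [D] matters. Elements of L^2 are
   represented by functions, equality in L^2 being [ae_eq_on]. *)
Section L2.
Context {R : realType}.
Variables (D : set R) (mu : {measure set (measurableTypeR R) -> \bar R}).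
Implicit Types (w : R -> R) (f g : R -> R[i]).

Definition ae_eq_on f g : Prop := {ae mu, forall x, D x -> f x = g x}.

(* squared norm in L^2(D, w mu), where [w mu] has density [w] w.r.t. [mu] *)
Definition sqnorm_w w f : \bar R :=
  (\int[mu]_(x in D) (normc (f x) ^+ 2 * w x)%:E)%E.

Definition L2w w f : Prop := cmeasurable_fun D f /\ (sqnorm_w w f < +oo)%E.

Definition L2 f : Prop :=
  cmeasurable_fun D f /\ (\int[mu]_(x in D) (normc (f x) ^+ 2)%:E < +oo)%E.

Definition L2_inner f g : R[i] := cintegral mu D (fun x => f x * (g x)^*).

Definition L2_eq f g : Prop := [/\ L2 f, L2 g & ae_eq_on f g].

(* [T] is a continuous extension, from the bounded functions of L^2(D, w1 mu)
   to the whole space, of an operator [A] into L^2(D, w0 mu). *)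
Record continuous_extension (w1 w0 : R -> R) (A T : (R -> R[i]) -> (R -> R[i])) : Prop :=
  ContinuousExtension {
  ext_L2w : forall f, L2w w1 f -> L2w w0 (T f);
  ext_eq : forall f, cbounded_on D f -> L2w w1 f -> ae_eq_on (T f) (A f);
  ext_continuous : forall f, L2w w1 f -> forall e : R, 0 < e ->
    exists2 del : R, 0 < del &
      forall f', L2w w1 f' -> (sqnorm_w w1 (fun x => f' x - f x)%R < del%:E)%E ->
        (sqnorm_w w0 (fun x => T f' x - T f x)%R < e%:E)%E
}.

End L2.

Record unitary_op (R : realType)
    (DX : set R) (mu : {measure set (measurableTypeR R) -> \bar R})
    (DY : set R) (nu : {measure set (measurableTypeR R) -> \bar R}) := UnitaryOp {
  ufun :> (R -> R[i]) -> (R -> R[i]);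
  uinv : (R -> R[i]) -> (R -> R[i]);
  ufun_L2 : forall f, L2 DX mu f -> L2 DY nu (ufun f);
  uinv_L2 : forall g, L2 DY nu g -> L2 DX mu (uinv g);
  ufun_ae : forall f f', L2_eq DX mu f f' -> ae_eq_on DY nu (ufun f) (ufun f');
  uinv_ae : forall g g', L2_eq DY nu g g' -> ae_eq_on DX mu (uinv g) (uinv g');
  ufun_linear : forall (a : R[i]) f f', L2 DX mu f -> L2 DX mu f' ->
    ae_eq_on DY nu (ufun (fun x => a * f x + f' x)) (fun y => a * ufun f y + ufun f' y);
  ufun_inner : forall f f', L2 DX mu f -> L2 DX mu f' ->
    L2_inner DY nu (ufun f) (ufun f') = L2_inner DX mu f f';
  ufunK : forall f, L2 DX mu f -> ae_eq_on DX mu (uinv (ufun f)) f;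
  uinvK : forall g, L2 DY nu g -> ae_eq_on DY nu (ufun (uinv g)) g
}.

Section Process.
Context {R : realType}.

Definition time_interval (S : set R) : Prop :=
  (exists2 b : R, 0 < b & S = `[0, b]%classic) \/ S = `[0, +oo[%classic.

Definition state_space (D : set R) : Prop := is_interval D \/ countable D.

(* Paths take values in [option R], where [None] is the cemetery. Right
   continuity at a time of life includes survival for a short while; left limits
   are required at times of life only, and need not belong to the state space. *)
Definition cadlag (S : set R) (p : R -> option R) : Prop :=
  forall s x, S s -> p s = Some x ->
  [/\ \forall u \near within S s^'+, p u <> None,
      odflt 0 (p u) @[u --> within S s^'+] --> x &
      0 < s -> cvg (odflt 0 (p u) @[u --> s^'-])].

Definition hits (Om : Type) (p : R -> Om -> option R) (s : R) (B : set R) : set Om :=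
  p s @^-1` (Some @` B).

(* sigma-algebra generated by the process between times [s] and [t] *)
Definition past (S : set R) (Om : Type) (p : R -> Om -> option R) (s t : R)
    : set (set Om) :=
  <<s [set E | exists v, exists B : set R,
        [/\ S v, s <= v <= t, measurable B & E = hits p v B]] >>.

(* [law s x] is the law of the process given that it is at [x] at time [s]:
   conditional expectations given [X_s = x] are expectations under [law s x]. *)
Record markov_process (S D : set R) d (Om : measurableType d) := MarkovProcess {
  path : R -> Om -> option R;
  law : R -> R -> probability Om R;
  path_measurable : forall s (B : set R), S s -> measurable B -> measurable (hits path s B);
  path_state : forall s w x, S s -> path s w = Some x -> D x;
  path_killed : forall s u w, S s -> S u -> s <= u -> path s w = None -> path u w = None;
  path_cadlag : forall w, cadlag S (path ^~ w);
  law_start : forall s x, S s -> D x -> law s x (hits path s [set x]) = 1%E;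
  law_measurable : forall s u (B : set R), S s -> S u -> s <= u -> measurable B ->
    measurable_fun D (fun x => law s x (hits path u B));
  law_markov : forall s t u x (A : set Om) (B : set R),
    S s -> S t -> S u -> s <= t <= u -> D x -> past S path s t A -> measurable B ->
    law s x (A `&` hits path u B) =
    (\int[law s x]_(w in A `&` hits path t setT) law t (odflt 0%R (path t w)) (hits path u B))%E
}.

Variables (S D : set R) (d : measure_display) (Om : measurableType d).
Variable X : markov_process S D Om.

(* the position at time [s], to be used on the event of being alive at [s] *)
Definition pos (s : R) (w : Om) : R := odflt 0 (path X s w).

(* E[ xi f(X_{s2}) | X_{s1} = x ], the integrand being zero if killed by time s2 *)
Definition cond_expect (s1 s2 : R) (xi : Om -> R[i]) (f : R -> R[i]) (x : R) : R[i] :=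
  cintegral (law X s1 x) [set w | path X s2 w <> None] (fun w => xi w * f (pos s2 w)).

Definition semigroup (s1 s2 : R) (f : R -> R[i]) : R -> R[i] :=
  cond_expect s1 s2 (fun=> 1) f.

End Process.

(* [f] multiplied by the real-valued function [h] *)
Definition rmulc (R : realType) (h : R -> R) (f : R -> R[i]) : R -> R[i] :=
  fun x => (h x)%:C * f x.

Record assumption_A (R : realType) (S T DX DY : set R)
    dX (OmX : measurableType dX) (X : markov_process S DX OmX)
    dY (OmY : measurableType dY) (Y : markov_process T DY OmY)
    (mu nu : {measure set (measurableTypeR R) -> \bar R})
    (F : unitary_op DX mu DY nu) (phi psi : R -> R[i]) (h j : R -> R -> R) : Prop :=
  AssumptionA {
  phi_continuous : ccontinuous_on DY phi;
  psi_continuous : ccontinuous_on DX psi;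
  phi_ge0 : forall y, DY y -> 0 <= complex.Re (phi y);
  psi_ge0 : forall x, DX x -> 0 <= complex.Re (psi x);
  h_measurable : forall s, S s -> measurable_fun DX (h s);
  j_measurable : forall t, T t -> measurable_fun DY (j t);
  h_gt0 : forall s x, S s -> DX x -> 0 < h s x;
  j_gt0 : forall t y, T t -> DY y -> 0 < j t y;
  semigroupX : forall s1 s2 f, S s1 -> S s2 -> s1 < s2 ->
    cbounded_on DX f -> L2w DX mu (fun x => h s2 x ^+ 2) f ->
    ae_eq_on DX mu (semigroup X s1 s2 f)
      (fun x => ((h s1 x)^-1)%:C *
         uinv F (fun y => cexp ((s1 - s2)%:C * phi y) * F (rmulc (h s2) f) y) x);
  semigroupY : forall t1 t2 g, T t1 -> T t2 -> t1 < t2 ->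
    cbounded_on DY g -> L2w DY nu (fun y => j t2 y ^+ 2) g ->
    ae_eq_on DY nu (semigroup Y t1 t2 g)
      (fun y => ((j t1 y)^-1)%:C *
         F (fun x => cexp ((t1 - t2)%:C * psi x) * uinv F (rmulc (j t2) g) x) y)
}.

(* Main.v *)
(* For bounded f, the Markov property peels off one time step after another:
   E[prod_(k < n) a_k(X_{s_k}) f(X_{s_n}) | X_{s_0}] is obtained by applying
   alternately the transition operators and the multiplications by the a_k.
   By (A) the step from s_k to s_{k+1} is, up to the weights h,
   F^-1 e^{-ds_k phi} F, so that h_{s_0} E[...] is the image of h_{s_n} f under an
   alternating product of F^-1 e^{-ds_k phi} F and e^{-dt_k psi}, each factor
   being a contraction of L^2. Bounded functions are dense, hence the product
   formula determines the continuous extension. For Y the product alternates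
   F e^{-dt_k psi} F^-1 and e^{-ds_k phi}; it is the same product conjugated
   by F. *)
Require Import Defs.
From HB Require Import structures.
From mathcomp Require Import all_boot all_order all_algebra.
From mathcomp Require Import finmap.
From mathcomp Require Import complex.
From mathcomp Require Import all_classical all_reals all_analysis.
From mathcomp Require Import measurable_realfun.
From mathcomp Require Import ring lra.
Import Order.TTheory GRing.Theory Num.Theory numFieldNormedType.Exports.
Local Open Scope classical_set_scope.
Local Open Scope ring_scope.
Local Open Scope complex_scope.

Set Implicit Arguments.
Unset Strict Implicit.
Unset Printing Implicit Defensive.

(** [F] need not map bounded functions to bounded functions, so the two conditional expectations
    cannot be compared on matching bounded [f] and [g]. Each process therefore gets its own product
    formula, valid on all of L^2, and only the resulting L^2 operators are compared. With the
    weights of X at s_0, ..., s_(n-1) and those of Y at t_1, ..., t_n, that comparison is a mere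
    regrouping of factors: no pair [F], [uinv F] ever has to be cancelled. Two gaps shape the rest.
    The Markov property is given for events only, and a monotone class argument carries it to
    bounded complex functionals. The transition formula of (A) holds only almost everywhere and only
    for bounded functions, yet it has to be iterated. Transition operators and the weights keep
    functions bounded, and an operator that does not increase distances in L^2 respects equality
    almost everywhere, so the exceptional null sets pass harmlessly through the remaining
    factors. *)

Section BoundedMeasurable.
Import HBNNSimple.
Context {R : realType}.

Definition mbounded d (T : measurableType d) (D : set T) (f : T -> R) : Prop :=
  measurable_fun D f /\ exists M : R, forall x, D x -> `|f x| <= M.

Context d (T : measurableType d).
Implicit Types (D : set T) (f g : T -> R).

Lemma mbounded_cst D (c : R) : mbounded D (cst c).
Proof. by split; [exact: measurable_cst | exists `|c|]. Qed.

Lemma mbounded_indic D (A : set T) : measurable A -> mbounded D (\1_A : T -> R).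
Proof.
move=> mA; split; first exact: measurable_indic.
by exists 1 => x _; rewrite indicE; case: (_ \in _); rewrite ?normr1 ?normr0.
Qed.

Lemma mboundedD D f g : mbounded D f -> mbounded D g ->
  mbounded D (fun x => f x + g x).
Proof.
move=> [mf [M fM]] [mg [K gK]]; split; first exact: measurable_funD.
exists (M + K) => x Dx; rewrite (le_trans (ler_normD _ _))// lerD ?fM ?gK//.
Qed.

Lemma mboundedM D f g : mbounded D f -> mbounded D g ->
  mbounded D (fun x => f x * g x).
Proof.
move=> [mf [M fM]] [mg [K gK]]; split; first exact: measurable_funM.
by exists (M * K) => x Dx; rewrite normrM ler_pM ?fM ?gK.
Qed.

Lemma mboundedN D f : mbounded D f -> mbounded D (fun x => - f x).
Proof.
move=> /(mboundedM (mbounded_cst D (-1))); congr mbounded.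
by apply/funext => x; rewrite mulN1r.
Qed.

Lemma mboundedB D f g : mbounded D f -> mbounded D g ->
  mbounded D (fun x => f x - g x).
Proof. by move=> mf /mboundedN; apply: mboundedD. Qed.

Lemma bounded_measurable_ind (Q : (T -> R) -> Prop) :
  (forall A, measurable A -> Q \1_A) ->
  (forall c f g, mbounded setT f -> mbounded setT g -> Q f -> Q g ->
    Q (fun x => c * f x + g x)) ->
  (forall (f_ : nat -> T -> R) f (M : R), (forall n, measurable_fun setT (f_ n)) ->
    (forall n x, `|f_ n x| <= M) -> (forall x, f_ ^~ x @ \oo --> f x) ->
    (forall n, Q (f_ n)) -> Q f) ->
  forall f, mbounded setT f -> Q f.
Proof.
move=> Q1 QD Qlim f [mf [M fM]].
have sum_mb (s : seq R) (B : R -> set T) : (forall r, measurable (B r)) ->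
    mbounded setT (fun x => \sum_(r <- s) r * \1_(B r) x) /\
    Q (fun x => \sum_(r <- s) r * \1_(B r) x).
  move=> mB; elim: s => [|r s [IHm IHQ]].
    rewrite (_ : (fun _ => _) = \1_set0); last first.
      by apply/funext => x; rewrite big_nil indicE in_set0.
    by split; [exact: mbounded_indic | exact: Q1].
  rewrite (_ : (fun _ => _) = (fun x => r * \1_(B r) x + \sum_(i <- s) i * \1_(B i) x)).
    have m1 : mbounded setT (\1_(B r) : T -> R) by exact: mbounded_indic.
    split; last by apply: QD => //; exact: Q1.
    by apply: mboundedD => //; apply: mboundedM => //; exact: mbounded_cst.
  by apply/funext => x; rewrite big_cons.
have Qs (s : {nnsfun T >-> R}) : mbounded setT s /\ Q s.
  rewrite (_ : (s : T -> R) = fun x =>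
      \sum_(r <- fset_set (range s)) r * \1_(s @^-1` [set r]) x); last first.
    by apply/funext => x; rewrite [LHS]fimfunE fsbig_finite.
  exact: sum_mb.
have mfM : measurable_fun setT (fun x => (f x + M)%:E).
  by apply/measurable_EFinP; apply: measurable_funD => //; exact: measurable_cst.
have fM0 x : setT x -> (0 <= (f x + M)%:E)%E.
  move=> _; have := fM x I; rewrite lee_fin ler_norml => /andP[+ _]; lra.
pose s_ := nnsfun_approx measurableT mfM.
have s_le n x : 0 <= s_ n x <= f x + M.
  apply/andP; split; first by [].
  rewrite -lee_fin /s_ nnsfun_approxE.
  exact: (@le_approx _ T R setT _ n x fM0 I).
(* The shift by -M is spelled out as a linear combination of indicators. *)
apply: (Qlim (fun n x => M * ((-1) * \1_setT x + 0 * \1_set0 x) + s_ n x) _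
  (M + (M + M))) => [n|n x|x|n].
- rewrite (_ : (fun _ => _) = (fun x => - M + s_ n x)); last first.
    by apply/funext => x; rewrite indicT indic0 /=; ring.
  by apply: measurable_funD => //; exact: measurable_cst.
- rewrite indicT indic0 /=.
  have := s_le n x; have := fM x I; rewrite !ler_norml => /andP[? ?] /andP[? ?].
  by apply/andP; split; lra.
- rewrite indicT indic0 /=.
  rewrite (_ : f x = M * (-1 * 1 + 0 * 0) + (f x + M)); last ring.
  apply: cvgD; first exact: cvg_cst.
  by have /fine_cvg := @cvg_nnsfun_approx _ T R setT measurableT _ mfM fM0 x I.
- have m1 : mbounded setT (\1_setT : T -> R) by exact: mbounded_indic.
  have m0 : mbounded setT (\1_set0 : T -> R) by exact: mbounded_indic.
  have [ms Qsn] := Qs (s_ n).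
  have m2 : mbounded setT (fun x : T => 0 * (\1_set0 x : R)).
    by apply: mboundedM => //; exact: mbounded_cst.
  have m3 : mbounded setT (fun x : T => -1 * (\1_setT x : R)).
    by apply: mboundedM => //; exact: mbounded_cst.
  apply: (QD M) => //; first by apply: mboundedD.
  apply: QD => //; first exact: Q1.
  rewrite (_ : (fun _ => _) = \1_set0); first exact: Q1.
  by apply/funext => x; rewrite indic0 mul0r.
Qed.

Lemma integrable_mbounded (m : {finite_measure set T -> \bar R}) D f :
  measurable D -> mbounded D f -> m.-integrable D (EFin \o f).
Proof.
move=> mD [mf [M fM]]; apply: measurable_bounded_integrable => //.
  by rewrite ltey_eq fin_num_measure.
exists `|M|; split => [|r Mr x Dx /=]; first by rewrite num_real.
by rewrite (le_trans (fM _ Dx))// (le_trans (ler_norm _))// ltW.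
Qed.

Lemma mbounded_patch D f : measurable D -> mbounded D f -> mbounded setT (f \_ D).
Proof.
move=> mD [mf [M fM]]; split; first exact: (measurable_restrictT f mD).1.
exists `|M| => x _; rewrite patchE; case: ifPn => [|_]; last by rewrite normr0.
by rewrite inE => Dx; rewrite (le_trans (fM _ Dx))// ler_norm.
Qed.

Lemma mboundedS {D : set T} f : mbounded setT f -> mbounded D f.
Proof.
by move=> [mf [M fM]]; split; [exact: measurable_funTS | exists M => x _; exact: fM].
Qed.

Lemma RintegralZD (m : {finite_measure set T -> \bar R}) (c : R) f g :
  mbounded setT f -> mbounded setT g ->
  \int[m]_w (c * f w + g w) = c * \int[m]_w f w + \int[m]_w g w.
Proof.
move=> mf mg; have mcf : mbounded setT (fun w => c * f w).
  by apply: mboundedM => //; exact: mbounded_cst.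
rewrite RintegralD ?RintegralZl//; exact: integrable_mbounded.
Qed.

Lemma normr_Rintegral_le (m : probability T R) f (M : R) :
  measurable_fun setT f -> (forall w, `|f w| <= M) -> `|\int[m]_w f w| <= M.
Proof.
move=> mf fM; have bf : mbounded setT f by split => //; exists M.
have bn : mbounded setT (fun w => `|f w|).
  by split; [exact: measurableT_comp | exists M => w _; rewrite normr_id].
apply: (le_trans (le_normr_Rintegral _ _)) => //; first exact: integrable_mbounded.
have <- : \int[m]_(_ in setT) M = M.
  by rewrite Rintegral_cst//; have /= -> := probability_setT m; rewrite mulr1.
apply: le_Rintegral => //; first exact: integrable_mbounded.
by apply: integrable_mbounded => //; exact: mbounded_cst.
Qed.

Lemma bounded_cvg_Rintegral (m : {finite_measure set T -> \bar R})
    (f_ : nat -> T -> R) f (M : R) :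
  (forall n, measurable_fun setT (f_ n)) -> (forall n x, `|f_ n x| <= M) ->
  (forall x, f_ ^~ x @ \oo --> f x) ->
  \int[m]_x f_ n x @[n --> \oo] --> \int[m]_x f x.
Proof.
move=> mf_ fM ff.
have iM : m.-integrable setT (EFin \o cst M).
  by apply: integrable_mbounded => //; exact: mbounded_cst.
have mf : measurable_fun setT f.
  by apply: (measurable_fun_cvg mf_) => x _; exact: ff.
have bf x : `|f x| <= M.
  have fx : `|f_ n x| @[n --> \oo] --> `|f x| by apply: cvg_norm; exact: ff.
  rewrite -(cvg_lim _ fx)//; apply: limr_le; last by apply: nearW => n; exact: fM.
  by apply/cvg_ex; exists `|f x|.
apply: fine_cvg; rewrite fineK; last first.
  apply: integrable_fin_num => //; apply: (@integrable_mbounded m setT f) => //.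
  by split => //; exists M.
apply: (@dominated_cvg _ T R m setT measurableT _ _ (EFin \o cst M)) => //.
- by move=> n; exact/measurable_EFinP.
- by move=> x _; apply/fine_cvgP; split; [exact: nearW | exact: ff].
- by move=> n x _; rewrite lee_fin fM.
Qed.

End BoundedMeasurable.

(** * The Markov property for functionals of the path *)

Section Killed.
Context {R : realType} d (T : measurableType d).

(* [oapp f 0] gives a killed path the value 0, so that integrals over the
   survival event become integrals over the whole space. *)
Lemma measurable_oapp (D : set R) (q : T -> option R) (f : R -> R) :
  measurable D -> measurable_fun D f ->
  (forall w x, q w = Some x -> D x) ->
  (forall B : set R, measurable B -> measurable (q @^-1` (Some @` B))) ->
  measurable_fun setT (fun w => oapp f 0 (q w)).
Proof.
move=> mD mf qD mq _ B mB; rewrite setTI.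
(* Killed paths have the value 0, so they all belong to the preimage of [B] if 0 is in [B], and none
   does otherwise. *)
pose N : set T := if `[< B 0 >] then ~` (q @^-1` (Some @` setT)) else set0.
rewrite [X in measurable X](_ : _ = q @^-1` (Some @` (D `&` f @^-1` B)) `|` N).
  apply: measurableU; first by apply: mq; exact: mf.
  rewrite /N; case: asboolP => _ //; apply: measurableC; exact: mq.
apply/seteqP; split => w /=.
  case qw : (q w) => [y|] /= By; first by left; exists y => //; split => //; exact: qD qw.
  by right; rewrite /N asboolT//= qw => -[y _].
case=> [[y [Dy By] <-]//|]; rewrite /N; case: asboolP => // B0 /=.
by case: (q w) => [y|//] []; exists y.
Qed.

Lemma mbounded_oapp (D : set R) (q : T -> option R) (f : R -> R) :
  measurable D -> mbounded D f ->
  (forall w x, q w = Some x -> D x) ->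
  (forall B : set R, measurable B -> measurable (q @^-1` (Some @` B))) ->
  mbounded setT (fun w => oapp f 0 (q w)).
Proof.
move=> mD [mf [M fM]] qD mq; split; first exact: measurable_oapp mf qD mq.
exists `|M| => w _; case qw : (q w) => [y|] /=; last by rewrite normr0.
by rewrite (le_trans (fM _ _) (ler_norm _))//; exact: qD qw.
Qed.

End Killed.

(** The generators of [past], named separately so that [g_sigma_algebraType] turns [Om] into a
    measurable type whose measurable sets are the past events. Monotone class induction can then be
    run over functionals of the past. *)
Definition past_generator {R : realType} (S : set R) (Om : Type)
    (p : R -> Om -> option R) (s t : R) : set (set Om) :=
  [set E | exists v, exists B : set R,
    [/\ S v, s <= v <= t, measurable B & E = hits p v B]].

Section RealMarkov.
Context {R : realType} {S D : set R} {d : measure_display} {Om : measurableType d}.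
Variable Z : markov_process S D Om.
Hypothesis mD : measurable (D : set R).

Local Notation ev u f := (fun w : Om => oapp f (0 : R) (Defs.path Z u w)).

Definition transition (s u : R) (f : R -> R) (x : R) : R :=
  \int[law Z s x]_w oapp f 0 (Defs.path Z u w).

Lemma mbounded_ev u (f : R -> R) : S u -> mbounded D f -> mbounded setT (ev u f).
Proof.
move=> Su mf; apply: (mbounded_oapp mD mf); first by move=> w x; exact: path_state.
by move=> B mB; exact: path_measurable.
Qed.

(** A living path is in [D]. Extending [f] by zero outside [D] is therefore harmless, and it yields
    a function on the whole line, as [bounded_measurable_ind] demands. *)
Lemma ev_patch u (f : R -> R) w : S u -> ev u f w = ev u (f \_ D) w.
Proof.
move=> Su /=; case pw : (Defs.path Z u w) => [y|]//=.
by rewrite patchT// inE; exact: path_state pw.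
Qed.

Lemma transition_patch s u (f : R -> R) : S u ->
  transition s u f = transition s u (f \_ D).
Proof.
by move=> Su; apply/funext => x; apply: eq_Rintegral => w _; exact: ev_patch.
Qed.

Let indic_ev u (B : set R) w :
  oapp \1_B 0 (Defs.path Z u w) = \1_(hits (Defs.path Z) u B) w :> R.
Proof.
rewrite /hits indicE; case pw : (Defs.path Z u w) => [y|] /=.
  rewrite indicE; congr ((_ : bool)%:R); apply/idP/idP; rewrite !inE /= pw.
    by exists y.
  by move=> [z Bz [<-]].
by rewrite memNset//= pw => -[].
Qed.

Let transition_indic s u (B : set R) x : S u -> measurable B ->
  transition s u \1_B x = fine (law Z s x (hits (Defs.path Z) u B)).
Proof.
move=> Su mB; rewrite /transition (eq_Rintegral _ (fun w _ => indic_ev u B w)).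
rewrite /Rintegral integral_indic ?setIT//.
exact: path_measurable.
Qed.

Let transitionZD s u c (f g : R -> R) x : S u -> mbounded D f -> mbounded D g ->
  transition s u (fun y => c * f y + g y) x = c * transition s u f x + transition s u g x.
Proof.
move=> Su mf mg; rewrite /transition -RintegralZD; [|exact: mbounded_ev..].
by apply: eq_Rintegral => w _; case: (Defs.path Z u w) => [y|] /=; rewrite ?mulr0 ?addr0.
Qed.

Let cvg_ev u (f_ : nat -> R -> R) (f : R -> R) w : (forall x, f_ ^~ x @ \oo --> f x) ->
  ev u (f_ n) w @[n --> \oo] --> ev u f w.
Proof.
by move=> ff /=; case: (Defs.path Z u w) => [y|] /=; [exact: ff | exact: cvg_cst].
Qed.

Let ev_le u (f : R -> R) (M : R) w : 0 <= M -> (forall x, `|f x| <= M) -> `|ev u f w| <= M.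
Proof. by move=> M0 fM /=; case: (Defs.path Z u w) => [y|] /=; rewrite ?normr0. Qed.

Let transition_cvg s u (f_ : nat -> R -> R) (f : R -> R) (M : R) x : S u ->
  (forall n, measurable_fun setT (f_ n)) -> (forall n x, `|f_ n x| <= M) ->
  (forall x, f_ ^~ x @ \oo --> f x) ->
  transition s u (f_ n) x @[n --> \oo] --> transition s u f x.
Proof.
move=> Su mf_ fM ff; have M0 : 0 <= M by apply: le_trans (fM 0%N 0).
apply: (bounded_cvg_Rintegral (M := M)) => [n|n w|w].
- have [] // := @mbounded_ev u (f_ n) Su.
  by apply: mboundedS; split => //; exists M.
- exact: ev_le.
- exact: cvg_ev.
Qed.

Let transition_le s u (f : R -> R) (M : R) x : S u -> measurable_fun setT f ->
  (forall x, `|f x| <= M) -> `|transition s u f x| <= M.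
Proof.
move=> Su mf fM; have M0 : 0 <= M by apply: le_trans (fM 0).
apply: normr_Rintegral_le; last by move=> w; exact: ev_le.
by have [] := @mbounded_ev u f Su (mboundedS (conj mf (ex_intro _ M (fun x _ => fM x)))).
Qed.

(** For indicators, measurability in the starting point is [law_measurable]; linearity and bounded
    convergence do the rest. The bound persists because each law has total mass one. *)
Lemma mbounded_transition s u (f : R -> R) : S s -> S u -> s <= u ->
  mbounded D f -> mbounded D (transition s u f).
Proof.
move=> Ss Su su mf; have := mbounded_patch mD mf.
rewrite (transition_patch s f Su).
move: (f \_ D : R -> R) => {mf}f mf; split; last first.
  by case: mf => mf [M fM]; exists M => x _; apply: transition_le => // y; exact: fM.
apply: (bounded_measurable_ind (Q := fun f => measurable_fun D (transition s u f)) _ _ _ mf)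
  => {f mf} [B mB|c f g mf mg IHf IHg|f_ f M mf_ fM ff IH].
- rewrite (_ : transition s u _ =
      fun x => fine (law Z s x (hits (Defs.path Z) u B))); last first.
    by apply/funext => x; exact: transition_indic.
  by apply: (measurableT_comp (@fine_measurable R setT measurableT)); exact: law_measurable.
- rewrite (_ : transition s u _ =
      fun x => c * transition s u f x + transition s u g x); last first.
    by apply/funext => x; apply: transitionZD => //; exact: mboundedS.
  by apply: measurable_funD => //; apply: measurable_funM => //; exact: measurable_cst.
- apply: (measurable_fun_cvg IH) => x _.
  exact: transition_cvg mf_ fM ff.
Qed.

Lemma past_measurable s t A : past S (Defs.path Z) s t A -> measurable A.
Proof.
apply: smallest_sub; first exact: sigma_algebra_measurable.
by move=> _ [v [B [Sv _ mB ->]]]; exact: path_measurable.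
Qed.

(** First half of a double monotone class argument: the past event [A] is fixed and [f] varies. For
    an indicator [f] the identity is [law_markov], the restriction to paths alive at [t] being
    encoded by the value 0 of [oapp]. *)
Let markov_event s t u x (A : set Om) (f : R -> R) :
  S s -> S t -> S u -> s <= t <= u -> D x -> past S (Defs.path Z) s t A ->
  mbounded setT f ->
  \int[law Z s x]_w (\1_A w * ev u f w) =
  \int[law Z s x]_w (\1_A w * ev t (transition t u f) w).
Proof.
move=> Ss St Su /[dup] stu /andP[st tu] Dx pA.
have mA := past_measurable pA.
have b1 : mbounded setT (\1_A : Om -> R) by exact: mbounded_indic.
have A1 w : `|\1_A w : R| <= 1.
  by rewrite indicE; case: (_ \in _); rewrite ?normr1 ?normr0.
move: f; apply: bounded_measurable_ind => [B mB|c f g mf mg IHf IHg|f_ f M mf_ fM ff IH].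
- rewrite /Rintegral; congr fine.
  transitivity (law Z s x (A `&` hits (Defs.path Z) u B)).
    rewrite -[X in law _ _ _ X]setIT -integral_indic//; last first.
      by apply: measurableI => //; exact: path_measurable.
    by apply: eq_integral => w _; rewrite indicI indic_ev.
  rewrite (law_markov Ss St Su stu Dx pA mB) [LHS]integral_mkcond.
  apply: eq_integral => w _; rewrite patchE /hits indicE in_setI.
  case: (boolP (w \in A)) => wA /=; last by rewrite mul0r.
  case pw : (Defs.path Z t w) => [y|] /=; last by rewrite memNset ?mulr0//= pw => -[].
  rewrite mem_set/= ?pw; last by exists y.
  rewrite mul1r transition_indic// fineK// fin_num_measure//.
  exact: path_measurable.
- have mf' := mboundedS mf; have mg' := mboundedS mg.
  have bZ v h : S v -> mbounded D h -> mbounded setT (fun w => \1_A w * ev v h w).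
    by move=> Sv mh; apply: mboundedM => //; exact: mbounded_ev.
  have bt h : mbounded D h -> mbounded D (transition t u h) by exact: mbounded_transition.
  transitivity (\int[law Z s x]_w (c * (\1_A w * ev u f w) + \1_A w * ev u g w)).
    apply: eq_Rintegral => w _; case: (Defs.path Z u w) => [y|] /=; ring.
  rewrite RintegralZD; [|exact: bZ..].
  rewrite IHf IHg -RintegralZD; [|by apply: bZ => //; exact: bt..].
  apply: eq_Rintegral => w _; case: (Defs.path Z t w) => [y|] /=; last by ring.
  by rewrite transitionZD//; ring.
- have M0 : 0 <= M by apply: le_trans (fM 0%N 0).
  have mbf n : mbounded D (f_ n) by apply: mboundedS; split => //; exists M.
  have cvg1 v (h_ : nat -> R -> R) h : S v -> (forall n, mbounded D (h_ n)) ->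
      (forall n x, `|h_ n x| <= M) -> (forall x, h_ ^~ x @ \oo --> h x) ->
      \int[law Z s x]_w (\1_A w * ev v (h_ n) w) @[n --> \oo] -->
      \int[law Z s x]_w (\1_A w * ev v h w).
    move=> Sv mh hM hh; apply: (bounded_cvg_Rintegral (M := M)) => [n|n w|w].
    + have [] // : mbounded setT (fun w => \1_A w * ev v (h_ n) w).
      by apply: mboundedM => //; exact: mbounded_ev.
    + rewrite normrM -[leRHS]mul1r ler_pM//; exact: ev_le.
    + by apply: cvgM; [exact: cvg_cst | exact: cvg_ev].
  (* By [IH] the integrals at time [u] and at time [t] form the same sequence, so their limits, the
     two sides of the goal, coincide. *)
  have := cvg1 u f_ f Su mbf fM ff; rewrite (funext IH) => cvgu.
  apply: (cvg_unique _ cvgu) => //; apply: cvg1 => // [n|n y|y]; first exact: mbounded_transition.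
    exact: transition_le.
  exact: transition_cvg fM ff.
Qed.

(** Second half: now [f] is fixed and [xi] varies, with the induction run over the sigma-algebra of
    the past, whose indicators are covered by [markov_event]. *)
Lemma real_markov s t u x (xi : Om -> R) (f : R -> R) :
  S s -> S t -> S u -> s <= t <= u -> D x ->
  mbounded (setT : set (g_sigma_algebraType (past_generator S (Defs.path Z) s t))) xi ->
  mbounded D f ->
  \int[law Z s x]_w (xi w * ev u f w) =
  \int[law Z s x]_w (xi w * ev t (transition t u f) w).
Proof.
move=> Ss St Su stu Dx mxi mf.
have bu : mbounded setT (ev u f) by exact: mbounded_ev.
have bt : mbounded setT (ev t (transition t u f)).
  by apply: mbounded_ev => //; apply: mbounded_transition => //; case/andP: stu.
have mfun (h : Om -> R) : measurable_fun
    (setT : set (g_sigma_algebraType (past_generator S (Defs.path Z) s t))) h ->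
    measurable_fun (setT : set Om) h.
  by move=> mh _ B mB; apply: (@past_measurable s t); exact: mh.
have mbdd (h : Om -> R) : mbounded
    (setT : set (g_sigma_algebraType (past_generator S (Defs.path Z) s t))) h ->
    mbounded (setT : set Om) h.
  by move=> [mh hM]; split => //; exact: mfun.
move: xi mxi; apply: (@bounded_measurable_ind _ _
  (g_sigma_algebraType (past_generator S (Defs.path Z) s t))) =>
  [A pA|c f1 g1 m1 m2 IH1 IH2|f_ g M mf_ fM ff IH].
- have := @markov_event s t u x A (f \_ D) Ss St Su stu Dx pA (mbounded_patch mD mf).
  rewrite -transition_patch// => <-.
  by apply: eq_Rintegral => w _; congr (_ * _); exact: ev_patch.
- have bZ (h k : Om -> R) : mbounded
      (setT : set (g_sigma_algebraType (past_generator S (Defs.path Z) s t))) h ->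
      mbounded setT k -> mbounded setT (fun w => h w * k w).
    by move=> mh mk; apply: mboundedM => //; exact: mbdd.
  transitivity (\int[law Z s x]_w (c * (f1 w * ev u f w) + g1 w * ev u f w)).
    by apply: eq_Rintegral => w _; ring.
  rewrite RintegralZD; [|exact: bZ..].
  rewrite IH1 IH2 -RintegralZD; [|exact: bZ..].
  by apply: eq_Rintegral => w _; ring.
- have cvg1 (k : Om -> R) : mbounded setT k ->
      \int[law Z s x]_w (f_ n w * k w) @[n --> \oo] --> \int[law Z s x]_w (g w * k w).
    move=> [mk [K kK]]; apply: (bounded_cvg_Rintegral (M := M * K)) => [n|n w|w].
    + by apply: measurable_funM => //; exact: mfun.
    + by rewrite normrM ler_pM//; exact: kK.
    + by apply: cvgM; [exact: ff | exact: cvg_cst].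
  have := cvg1 _ bu; rewrite (funext IH) => cvgu.
  exact: (cvg_unique _ cvgu (cvg1 _ bt)).
Qed.

End RealMarkov.

(** The operator product a_0 B_0 a_1 B_1 ... a_(n-1) B_(n-1). The recursion splits off the factor of
    highest index, which acts first on [u], because the Markov property removes the last time step
    first. *)
Fixpoint chain {R : realType} (a : nat -> R -> R[i])
    (B : nat -> (R -> R[i]) -> (R -> R[i])) n (u : R -> R[i]) : R -> R[i] :=
  if n is m.+1 then chain a B m (fun x => a m x * B m u x) else u.

(** * Complex-valued functionals and iterated conditioning *)

Section ComplexBounded.
Context {R : realType} d (T : measurableType d).
Implicit Types (D : set T) (f g : T -> R[i]).

Definition cmbounded D f : Prop :=
  mbounded D (fun x => complex.Re (f x)) /\ mbounded D (fun x => complex.Im (f x)).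

Lemma ReM (z w : R[i]) :
  complex.Re (z * w) = complex.Re z * complex.Re w - complex.Im z * complex.Im w.
Proof. by case: z w => [a b] [c e]. Qed.

Lemma ImM (z w : R[i]) :
  complex.Im (z * w) = complex.Re z * complex.Im w + complex.Im z * complex.Re w.
Proof. by case: z w => [a b] [c e]. Qed.

Lemma cmboundedM D f g : cmbounded D f -> cmbounded D g ->
  cmbounded D (fun x => f x * g x).
Proof.
move=> [Rf If] [Rg Ig]; split.
  under eq_fun do rewrite ReM.
  by apply: mboundedB; exact: mboundedM.
under eq_fun do rewrite ImM.
by apply: mboundedD; exact: mboundedM.
Qed.

Lemma cmbounded_cst D (z : R[i]) : cmbounded D (cst z).
Proof. by split; exact: mbounded_cst. Qed.

Lemma cmbounded_prod D (f_ : nat -> T -> R[i]) n :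
  (forall k, (k < n)%N -> cmbounded D (f_ k)) ->
  cmbounded D (fun x => \prod_(k < n) f_ k x).
Proof.
elim: n => [|n IH] mf.
  by under eq_fun do rewrite big_ord0; exact: cmbounded_cst.
under eq_fun do rewrite big_ord_recr.
by apply: cmboundedM; [apply: IH => k kn; exact/mf/leqW | exact: mf].
Qed.

Lemma sqr_normcE (z : R[i]) :
  ComplexField.Normc.normc z ^+ 2 = complex.Re z ^+ 2 + complex.Im z ^+ 2.
Proof. by case: z => a b /=; rewrite sqr_sqrtr// addr_ge0 ?sqr_ge0. Qed.

Lemma normc_ge0 (z : R[i]) : 0 <= ComplexField.Normc.normc z.
Proof. by case: z => a b /=; exact: sqrtr_ge0. Qed.

End ComplexBounded.

Lemma cmboundedP {R : realType} (D : set R) (f : R -> R[i]) :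
  cmbounded D f <-> cmeasurable_fun D f /\ cbounded_on D f.
Proof.
split=> [[[mR [M fM]] [mI [K fK]]]|[[mR mI] [M fM]]].
  split=> //; exists (M + K) => x Dx.
  have := fM x Dx; have := fK x Dx; case: (f x) => a b /= bK aM.
  have a0 := normr_ge0 a; have b0 := normr_ge0 b.
  rewrite -(@ler_pXn2r _ 2)// ?nnegrE ?sqrtr_ge0 ?(le_trans _ (lerD aM bK)) ?addr_ge0//.
  rewrite sqr_sqrtr ?addr_ge0 ?sqr_ge0// -(real_normK (num_real a)) -(real_normK (num_real b)).
  by nra.
have le_normc (z : R[i]) : `|complex.Re z| <= ComplexField.Normc.normc z /\
    `|complex.Im z| <= ComplexField.Normc.normc z.
  by split; rewrite -(@ler_pXn2r _ 2) ?nnegrE ?normc_ge0// sqr_normcE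
    real_normK ?num_real// ?lerDl ?lerDr sqr_ge0.
by split; split=> //; exists M => x Dx; case: (le_normc (f x)) => ? ?; apply: le_trans (fM _ Dx).
Qed.

Section ComplexMarkov.
Context {R : realType} {S D : set R} {d : measure_display} {Om : measurableType d}.
Variable Z : markov_process S D Om.
Hypothesis mD : measurable (D : set R).
Local Notation Re := (@complex.Re R).
Local Notation Im := (@complex.Im R).
Local Notation ev u f := (fun w : Om => oapp f (0 : R) (Defs.path Z u w)).

(** Reduces to four real integrals over the whole space, each of the shape treated by
    [real_markov]. *)
Lemma cond_expectE s u (xi : Om -> R[i]) (f : R -> R[i]) x : S u ->
  cmbounded setT xi -> cmbounded D f ->
  cond_expect Z s u xi f x =
  (\int[law Z s x]_w (Re (xi w) * ev u (Re \o f) w) -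
   \int[law Z s x]_w (Im (xi w) * ev u (Im \o f) w)) +i*
  (\int[law Z s x]_w (Re (xi w) * ev u (Im \o f) w) +
   \int[law Z s x]_w (Im (xi w) * ev u (Re \o f) w)).
Proof.
move=> Su [mR mI] [fR fI].
have bM (h : Om -> R) (k : R -> R) : mbounded setT h -> mbounded D k ->
    (law Z s x).-integrable setT (EFin \o (fun w => h w * ev u k w)).
  move=> mh mk; apply: integrable_mbounded => //.
  by apply: mboundedM => //; exact: mbounded_ev.
rewrite -RintegralB ?bM// -RintegralD ?bM// /cond_expect /cintegral.
congr (_ +i* _); rewrite Rintegral_mkcond; apply: eq_Rintegral => w _;
  rewrite patchE /pos; case: ifPn => [|].
- by rewrite inE /=; case: (Defs.path Z u w) => // y _; rewrite ReM.
- by rewrite notin_setE /= => /contrapT ->; rewrite /= !mulr0 subr0.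
- by rewrite inE /=; case: (Defs.path Z u w) => // y _; rewrite ImM.
- by rewrite notin_setE /= => /contrapT ->; rewrite /= !mulr0 addr0.
Qed.

Lemma semigroupE s u (f : R -> R[i]) x :
  semigroup Z s u f x = transition Z s u (Re \o f) x +i* transition Z s u (Im \o f) x.
Proof.
rewrite /semigroup /cond_expect /cintegral /transition.
congr (_ +i* _); rewrite Rintegral_mkcond; apply: eq_Rintegral => w _;
  rewrite patchE /pos mul1r; case: ifPn => [|].
- by rewrite inE /=; case: (Defs.path Z u w).
- by rewrite notin_setE /= => /contrapT ->.
- by rewrite inE /=; case: (Defs.path Z u w).
- by rewrite notin_setE /= => /contrapT ->.
Qed.

Lemma cmbounded_semigroup s u (f : R -> R[i]) : S s -> S u -> s <= u ->
  cmbounded D f -> cmbounded D (semigroup Z s u f).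
Proof.
move=> Ss Su su [fR fI]; split; under eq_fun do rewrite semigroupE /=;
  exact: mbounded_transition.
Qed.

Lemma complex_markov s t u x (xi : Om -> R[i]) (f : R -> R[i]) :
  S s -> S t -> S u -> s <= t <= u -> D x ->
  cmbounded (setT : set (g_sigma_algebraType (past_generator S (Defs.path Z) s t))) xi ->
  cmbounded D f ->
  cond_expect Z s u xi f x = cond_expect Z s t xi (semigroup Z t u f) x.
Proof.
move=> Ss St Su /[dup] stu /andP[st tu] Dx [pR pI] [fR fI].
have past_mb (h : Om -> R) : mbounded
    (setT : set (g_sigma_algebraType (past_generator S (Defs.path Z) s t))) h ->
    mbounded (setT : set Om) h.
  move=> [mh hM]; split => // _ B mB.
  by apply: (@past_measurable _ _ _ _ _ Z s t); exact: mh.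
have mxi : cmbounded (setT : set Om) xi by split; exact: past_mb.
have mf : cmbounded D (semigroup Z t u f) by exact: cmbounded_semigroup.
rewrite !cond_expectE//.
have step (h : Om -> R) (k : R -> R) : mbounded (setT : set
      (g_sigma_algebraType (past_generator S (Defs.path Z) s t))) h -> mbounded D k ->
    forall k', (forall y, k' y = transition Z t u k y) ->
    \int[law Z s x]_w (h w * ev u k w) = \int[law Z s x]_w (h w * ev t k' w).
  by move=> mh mk k' /funext ->; exact: real_markov.
by congr (_ +i* _); congr (_ + _); (try congr (- _)); apply: step => // y;
  rewrite /comp semigroupE.
Qed.

Lemma eq_cond_expect s u (xi xi' : Om -> R[i]) (f f' : R -> R[i]) x : S u ->
  (forall w, Defs.path Z u w <> None ->
    xi w * f (pos Z u w) = xi' w * f' (pos Z u w)) ->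
  cond_expect Z s u xi f x = cond_expect Z s u xi' f' x.
Proof.
move=> Su eqf; rewrite /cond_expect /cintegral.
by congr (_ +i* _); apply: eq_Rintegral => w; rewrite inE /= => lw; rewrite eqf.
Qed.

(** Under [law Z s x] the path is at [x] at time [s] with probability one, so the integrand is
    almost surely constant. This starts the induction over time steps. *)
Lemma transitionxx s (f : R -> R) x : S s -> D x -> mbounded D f ->
  transition Z s s f x = f x.
Proof.
move=> Ss Dx mf; have mH : measurable (hits (Defs.path Z) s [set x]).
  exact: path_measurable.
have -> : f x = \int[law Z s x]_(_ in setT) f x.
  by rewrite Rintegral_cst//; have /= -> := probability_setT (law Z s x); rewrite mulr1.
congr fine; apply: ae_eq_integral => //.
- by apply/measurable_EFinP; case: (mbounded_ev Z mD Ss mf).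
- exists (~` hits (Defs.path Z) s [set x]); split; first exact: measurableC.
    have := probability_setC (law Z s x) mH; rewrite /= => ->.
    by rewrite law_start// subee.
  move=> w /= + hw; apply => _; move: hw => [y ->] <-//.
Qed.

(** Induction on [n] with [f] general: conditioning at time [r n] trades [f] for [a n] times its
    image under the last transition operator, which is again bounded and measurable. The equality
    holds at every point of [D], with no null set. *)
Lemma cond_expect_prod (r : nat -> R) (a : nat -> R -> R[i]) n (f : R -> R[i]) x :
  (forall k, (k <= n)%N -> S (r k)) -> (forall k, (k < n)%N -> r k < r k.+1) ->
  (forall k, (k < n)%N -> cmbounded D (a k)) -> cmbounded D f -> D x ->
  cond_expect Z (r 0%N) (r n) (fun w => \prod_(k < n) a k (pos Z (r k) w)) f x =
  chain a (fun k => semigroup Z (r k) (r k.+1)) n f x.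
Proof.
move=> Sr r_incr ma mf Dx.
have r_le k m : (k <= m)%N -> (m <= n)%N -> r k <= r m.
  elim: m => [|m IH]; first by rewrite leqn0 => /eqP ->.
  rewrite leq_eqVlt => /predU1P[->//|]; rewrite ltnS => km mn.
  exact: le_trans (IH km (ltnW mn)) (ltW (r_incr m mn)).
elim: n f mf Sr r_incr ma r_le => [|n IH] f [mR mI] Sr r_incr ma r_le /=.
  have S0 : S (r 0%N) by exact: Sr.
  rewrite (@eq_cond_expect _ _ _ (fun=> 1) _ f)//; last first.
    by move=> w _; rewrite big_ord0.
  rewrite [LHS]semigroupE !transitionxx//=.
  by case: (f x).
have mf : cmbounded D f by [].
have Sk k : (k <= n)%N -> S (r k) by move=> kn; exact/Sr/leqW.
have r_n : r n <= r n.+1 by exact: r_le.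
have r_0 : r 0%N <= r n by exact: r_le.
rewrite -(IH (fun y => a n y * _ y)); last 5 first.
- apply: cmboundedM; first exact: ma.
  by apply: cmbounded_semigroup => //; [exact: Sk | exact: Sr].
- exact: Sk.
- by move=> k kn; exact/r_incr/leqW.
- by move=> k kn; exact/ma/leqW.
- by move=> k m km mn; exact/r_le/leqW.
(* On a killed path [pos] is the arbitrary point 0. [eta] is 0 there instead, which lets
   [mbounded_oapp] show that it is bounded and measurable for the past. Nothing changes on paths
   alive at the final time, as these were alive at every earlier [r k]. *)
pose eta k w : R[i] := oapp (a k) 0 (Defs.path Z (r k) w).
have etaE k u w : (k <= n)%N -> S u -> r k <= u -> Defs.path Z u w <> None ->
    eta k w = a k (pos Z (r k) w).
  move=> kn Su ku lu; rewrite /eta /pos; case pk : (Defs.path Z (r k) w) => //=.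
  by case: lu; apply: path_killed pk => //; exact: Sk.
rewrite (@eq_cond_expect _ _ _ (fun w => \prod_(k < n.+1) eta k w) _ f); last 2 first.
- exact: Sr.
- move=> w lw; congr (_ * _); apply: eq_bigr => k _.
  rewrite -(etaE _ (r n.+1))//; [by rewrite -ltnS|exact: Sr|].
  by apply: r_le => //; exact: ltnW.
rewrite (@complex_markov (r 0%N) (r n))//; [|exact: Sk|exact: Sk|exact: Sr|exact/andP|].
  apply: eq_cond_expect; first exact: Sk.
  move=> w lw; rewrite mulrA big_ord_recr /=; congr (_ * _ * _).
    apply: eq_bigr => k _; rewrite (etaE _ (r n))//; [exact: ltnW|exact: Sk|].
    by apply: r_le => //; exact: ltnW.
  by rewrite (etaE _ (r n))//; exact: Sk.
apply: cmbounded_prod => k; rewrite ltnS => kn.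
have [aR aI] := ma k kn.
have Sk' := Sk k kn.
have kq : r 0%N <= r k <= r n by rewrite !r_le//; exact: leqW.
have mq (B : set R) : measurable B ->
    measurable (Defs.path Z (r k) @^-1` (Some @` B) :
      set (g_sigma_algebraType (past_generator S (Defs.path Z) (r 0%N) (r n)))).
  by move=> mB; apply: sub_sigma_algebra; exists (r k), B.
have qD w y : Defs.path Z (r k) w = Some y -> D y by exact: path_state.
split; rewrite /eta.
  rewrite (_ : (fun w => _) = fun w => oapp (Re \o a k) 0 (Defs.path Z (r k) w)).
    exact: (mbounded_oapp mD aR).
  by apply/funext => w; case: (Defs.path Z (r k) w).
rewrite (_ : (fun w => _) = fun w => oapp (Im \o a k) 0 (Defs.path Z (r k) w)).
  exact: (mbounded_oapp mD aI).
by apply/funext => w; case: (Defs.path Z (r k) w).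
Qed.

End ComplexMarkov.

(** * Contractions of weighted L^2 spaces *)

Section L2Theory.
Context {R : realType}.
Local Notation normc := (@ComplexField.Normc.normc R).
Local Notation Re := (@complex.Re R).
Local Notation Im := (@complex.Im R).
Local Open Scope ereal_scope.

Definition sqnorm (D : set R) (mu : {measure set (measurableTypeR R) -> \bar R})
  (f : R -> R[i]) : \bar R := \int[mu]_(x in D) (normc (f x) ^+ 2)%:E.

(** Stated for distances rather than norms: operators act on representatives, where linearity is
    available only almost everywhere. In this form the property composes at once and yields both
    continuity and compatibility with equality almost everywhere. *)
Definition contraction (D : set R) (mu : {measure set (measurableTypeR R) -> \bar R})
    (D' : set R) (nu : {measure set (measurableTypeR R) -> \bar R})
    (B : (R -> R[i]) -> (R -> R[i])) : Prop :=
  (forall f, L2 D mu f -> L2 D' nu (B f)) /\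
  (forall f f', L2 D mu f -> L2 D mu f' ->
    sqnorm D' nu (fun x => B f' x - B f x)%R <= sqnorm D mu (fun x => f' x - f x)%R).

Lemma cmeasurable_cst (D : set R) (z : R[i]) : cmeasurable_fun D (cst z).
Proof. by split; exact: measurable_cst. Qed.

Lemma cmeasurableM (D : set R) (f g : R -> R[i]) :
  cmeasurable_fun D f -> cmeasurable_fun D g -> cmeasurable_fun D (fun x => f x * g x)%R.
Proof.
move=> [fR fI] [gR gI]; split.
  by under eq_fun do rewrite ReM; apply: measurable_funB; exact: measurable_funM.
by under eq_fun do rewrite ImM; apply: measurable_funD; exact: measurable_funM.
Qed.

Lemma cmeasurableD (D : set R) (f g : R -> R[i]) :
  cmeasurable_fun D f -> cmeasurable_fun D g -> cmeasurable_fun D (fun x => f x + g x)%R.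
Proof.
move=> [fR fI] [gR gI]; split.
  rewrite (_ : (fun _ => _) = fun x => (Re (f x) + Re (g x))%R); first exact: measurable_funD.
  by apply/funext => x; case: (f x) (g x) => [? ?] [? ?].
rewrite (_ : (fun _ => _) = fun x => (Im (f x) + Im (g x))%R); first exact: measurable_funD.
by apply/funext => x; case: (f x) (g x) => [? ?] [? ?].
Qed.

Lemma cmeasurableN (D : set R) (g : R -> R[i]) :
  cmeasurable_fun D g -> cmeasurable_fun D (fun x => - g x)%R.
Proof.
move=> [gR gI]; split.
  rewrite (_ : (fun _ => _) = fun x => (- Re (g x))%R); first exact: measurable_funN.
  by apply/funext => x; case: (g x).
rewrite (_ : (fun _ => _) = fun x => (- Im (g x))%R); first exact: measurable_funN.
by apply/funext => x; case: (g x).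
Qed.

Lemma cmeasurableB (D : set R) (f g : R -> R[i]) :
  cmeasurable_fun D f -> cmeasurable_fun D g -> cmeasurable_fun D (fun x => f x - g x)%R.
Proof. by move=> mf /cmeasurableN; exact: cmeasurableD. Qed.

Lemma cmeasurable_rmulc (D : set R) (h : R -> R) (f : R -> R[i]) :
  measurable_fun D h -> cmeasurable_fun D f -> cmeasurable_fun D (rmulc h f).
Proof.
move=> mh; apply: cmeasurableM; split => //=; exact: measurable_cst.
Qed.

Lemma normc_rmulc (h : R -> R) (f : R -> R[i]) x :
  (normc (rmulc h f x) ^+ 2 = normc (f x) ^+ 2 * h x ^+ 2)%R.
Proof.
by rewrite /rmulc ComplexField.Normc.normcM exprMn mulrC; congr (_ * _)%R;
  rewrite sqr_normcE /= expr0n addr0.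
Qed.

Lemma sqnorm_wE D mu (h : R -> R) (f : R -> R[i]) :
  sqnorm_w D mu (fun x => h x ^+ 2)%R f = sqnorm D mu (rmulc h f).
Proof. by apply: eq_integral => x _; rewrite normc_rmulc. Qed.

Lemma rmulcB (h : R -> R) (f g : R -> R[i]) :
  rmulc h (fun x => f x - g x)%R = (fun x => rmulc h f x - rmulc h g x)%R.
Proof. by apply/funext => x; rewrite /rmulc mulrBr. Qed.

(* Typeclass search does not find the filter instance on [measurableTypeR]. *)
Lemma aeS (mu : {measure set (measurableTypeR R) -> \bar R}) (P Q : R -> Prop) :
  (forall x, P x -> Q x) -> {ae mu, forall x, P x} -> {ae mu, forall x, Q x}.
Proof. exact: (@filterS _ _ (ae_filter_ringOfSetsType mu)). Qed.

Lemma aeS2 (mu : {measure set (measurableTypeR R) -> \bar R}) (P P' Q : R -> Prop) :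
  (forall x, P x -> P' x -> Q x) ->
  {ae mu, forall x, P x} -> {ae mu, forall x, P' x} -> {ae mu, forall x, Q x}.
Proof. exact: (@filterS2 _ _ (ae_filter_ringOfSetsType mu)). Qed.

Lemma ae_eq_on_trans (D : set R) (mu : {measure set (measurableTypeR R) -> \bar R})
    (f g h : R -> R[i]) :
  ae_eq_on D mu f g -> ae_eq_on D mu g h -> ae_eq_on D mu f h.
Proof. by apply: aeS2 => x fg gh Dx; rewrite fg// gh. Qed.

Section Space.
Variables (D : set R) (mD : measurable D)
  (mu : {measure set (measurableTypeR R) -> \bar R}).
Implicit Types f g : R -> R[i].

Lemma measurable_sqnormc f : cmeasurable_fun D f ->
  measurable_fun (D : set (measurableTypeR R)) (fun x => (normc (f x) ^+ 2)%:E).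
Proof.
move=> [fR fI]; apply/measurable_EFinP; under eq_fun do rewrite sqr_normcE.
by apply: measurable_funD; exact: measurable_funX.
Qed.

Lemma sqnorm_ge0 f : 0 <= sqnorm D mu f.
Proof. by apply: integral_ge0 => x _; rewrite lee_fin sqr_ge0. Qed.

Lemma le_sqnorm f g : cmeasurable_fun D f -> cmeasurable_fun D g ->
  (forall x, D x -> normc (f x) <= normc (g x))%R -> sqnorm D mu f <= sqnorm D mu g.
Proof.
move=> mf mg fg; apply: ge0_le_integral => //.
- by move=> x _; rewrite lee_fin sqr_ge0.
- exact: measurable_sqnormc.
- exact: measurable_sqnormc.
- by move=> x Dx; rewrite lee_fin ler_pXn2r ?nnegrE ?normc_ge0 ?fg.
Qed.

Lemma normcM_le (a : R -> R[i]) f : (forall x, D x -> normc (a x) <= 1)%R ->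
  forall x, D x -> (normc (a x * f x) <= normc (f x))%R.
Proof.
move=> a1 x Dx; rewrite ComplexField.Normc.normcM -[leRHS]mul1r.
by apply: ler_wpM2r; [exact: normc_ge0 | exact: a1].
Qed.

Lemma L2M (a : R -> R[i]) f : cmeasurable_fun D a ->
  (forall x, D x -> normc (a x) <= 1)%R -> L2 D mu f -> L2 D mu (fun x => a x * f x)%R.
Proof.
move=> ma a1 [mf foo]; split; first exact: cmeasurableM.
apply: le_lt_trans foo; apply: le_sqnorm => //; first exact: cmeasurableM.
exact: normcM_le.
Qed.

(** Pointwise, |a + b|^2 + |a - b|^2 = 2|a|^2 + 2|b|^2. This replaces the triangle inequality and
    keeps all estimates in terms of squared norms. *)
Lemma sqnormD_le f g : cmeasurable_fun D f -> cmeasurable_fun D g ->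
  sqnorm D mu (fun x => f x + g x)%R <= 2%:E * sqnorm D mu f + 2%:E * sqnorm D mu g.
Proof.
move=> mf mg; have mf2 := measurable_sqnormc mf; have mg2 := measurable_sqnormc mg.
have s0 f' x : D x -> 0 <= (normc (f' x) ^+ 2)%:E by rewrite lee_fin sqr_ge0.
have s2 f' x : D x -> 0 <= 2%:E * (normc (f' x) ^+ 2)%:E.
  by rewrite mule_ge0 ?lee_fin ?sqr_ge0.
have m2 f' : cmeasurable_fun D f' ->
    measurable_fun (D : set (measurableTypeR R)) (fun x => 2%:E * (normc (f' x) ^+ 2)%:E).
  by move=> mf'; apply: measurable_funeM; exact: measurable_sqnormc.
rewrite -(ge0_integralZl_EFin mu mD (s0 f) mf2)// -(ge0_integralZl_EFin mu mD (s0 g) mg2)//.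
rewrite -(ge0_integralD mu mD (s2 f) (m2 f mf) (s2 g) (m2 g mg)).
apply: ge0_le_integral => //.
- by move=> x _; rewrite lee_fin sqr_ge0.
- by apply: measurable_sqnormc; exact: cmeasurableD.
- by apply: emeasurable_funD; exact: m2.
- move=> x _; rewrite -!EFinM -EFinD lee_fin !sqr_normcE.
  case: (f x) (g x) => [a b] [c e] /=; have := sqr_ge0 (a - c); have := sqr_ge0 (b - e).
  nra.
Qed.

Lemma L2D f g : L2 D mu f -> L2 D mu g -> L2 D mu (fun x => f x + g x)%R.
Proof.
move=> [mf foo] [mg goo]; split; first exact: cmeasurableD.
apply: le_lt_trans (sqnormD_le mf mg) _.
by apply: lte_add_pinfty; rewrite lte_mul_pinfty.
Qed.

Lemma sqnormN f : sqnorm D mu (fun x => - f x)%R = sqnorm D mu f.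
Proof.
by apply: eq_integral => x _; rewrite !sqr_normcE; case: (f x) => a b /=; rewrite !sqrrN.
Qed.

Lemma L2B f g : L2 D mu f -> L2 D mu g -> L2 D mu (fun x => f x - g x)%R.
Proof.
move=> Lf [mg goo]; apply: L2D => //; split; last by rewrite -/(sqnorm _ _ _) sqnormN.
exact: cmeasurableN.
Qed.

Lemma ae_sqnorm f g : cmeasurable_fun D f -> cmeasurable_fun D g ->
  ae_eq_on D mu f g -> sqnorm D mu f = sqnorm D mu g.
Proof.
move=> mf mg fg; apply: ge0_ae_eq_integral => //.
- exact: measurable_sqnormc.
- exact: measurable_sqnormc.
- by move=> x _; rewrite lee_fin sqr_ge0.
- by move=> x _; rewrite lee_fin sqr_ge0.
- by apply: aeS fg => x fg Dx; rewrite fg.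
Qed.

Lemma L2_ae f g : cmeasurable_fun D f -> ae_eq_on D mu f g -> L2 D mu g -> L2 D mu f.
Proof. by move=> mf fg [mg goo]; split=> //; rewrite -/(sqnorm D mu f) (ae_sqnorm mf mg fg). Qed.

Lemma sqnorm_eq0 f g : cmeasurable_fun D f -> cmeasurable_fun D g ->
  sqnorm D mu (fun x => f x - g x)%R = 0 -> ae_eq_on D mu f g.
Proof.
move=> mf mg fg0; have mfg := cmeasurableB mf mg.
have abs0 : \int[mu]_(x in D) `|(normc (f x - g x)%R ^+ 2)%:E| = 0.
  by rewrite -fg0; apply: eq_integral => x _; rewrite gee0_abs// lee_fin sqr_ge0.
apply: aeS ((ae_eq_integral_abs mu mD (measurable_sqnormc mfg)).1 abs0).
move=> x /[apply] -[] /eqP.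
rewrite expf_eq0/= => /eqP /ComplexField.Normc.eq0_normc /eqP.
by rewrite subr_eq0 => /eqP.
Qed.

End Space.

(** Distance zero stays distance zero. This is what permits substituting an almost-everywhere
    identity inside a product of operators. *)
Lemma contraction_ae D mu D' nu B f f' : measurable D -> measurable D' ->
  contraction D mu D' nu B -> L2 D mu f -> L2 D mu f' ->
  ae_eq_on D mu f f' -> ae_eq_on D' nu (B f) (B f').
Proof.
move=> mD mD' [BL Bc] Lf Lf' ff'.
have [mBf _] := BL f Lf; have [mBf' _] := BL f' Lf'.
apply: sqnorm_eq0 => //; apply/eqP; rewrite eq_le sqnorm_ge0 andbT.
apply: le_trans (Bc _ _ Lf' Lf) _.
rewrite (@ae_sqnorm _ mD _ _ (cst 0%R)).
- by rewrite /sqnorm integral0_eq// => x _; rewrite ComplexField.Normc.normc0 expr0n.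
- by case: (L2B mD Lf Lf').
- by split; exact: measurable_cst.
- by apply: aeS ff' => x ff' Dx; rewrite ff'// subrr.
Qed.

Lemma contraction_id D mu : contraction D mu D mu id.
Proof. by []. Qed.

Lemma contraction_comp D mu D' nu D'' la (B C : (R -> R[i]) -> R -> R[i]) :
  contraction D mu D' nu B -> contraction D' nu D'' la C ->
  contraction D mu D'' la (fun u => C (B u)).
Proof.
move=> [BL Bc] [CL Cc]; split=> [f Lf|f f' Lf Lf']; first exact/CL/BL.
exact: le_trans (Cc _ _ (BL _ Lf) (BL _ Lf')) (Bc _ _ Lf Lf').
Qed.

Lemma contractionM D mu D' nu (a : R -> R[i]) B : measurable D' ->
  cmeasurable_fun D' a -> (forall x, D' x -> normc (a x) <= 1)%R ->
  contraction D mu D' nu B -> contraction D mu D' nu (fun u x => a x * B u x)%R.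
Proof.
move=> mD' ma a1 [BL Bc]; split=> [f Lf|f f' Lf Lf']; first exact/L2M/BL.
apply: le_trans (Bc _ _ Lf Lf').
rewrite (_ : (fun _ => _) = fun x => a x * (B f' x - B f x))%R; last first.
  by apply/funext => x; rewrite mulrBr.
have [mB _] := L2B mD' (BL _ Lf') (BL _ Lf).
by apply: le_sqnorm => //; [exact: cmeasurableM | exact: normcM_le].
Qed.

Lemma contraction_chain D mu (a : nat -> R -> R[i]) B n : measurable D ->
  (forall k, (k < n)%N -> cmeasurable_fun D (a k)) ->
  (forall k x, (k < n)%N -> D x -> normc (a k x) <= 1)%R ->
  (forall k, (k < n)%N -> contraction D mu D mu (B k)) ->
  contraction D mu D mu (chain a B n).
Proof.
move=> mD; elim: n => [|n IH] ma a1 cB /=; first exact: contraction_id.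
apply: (@contraction_comp D mu D mu D mu (fun u x => a n x * B n u x)%R).
  by apply: contractionM => //; [exact: ma | move=> x; exact: a1 | exact: cB].
by apply: IH => [k kn|k x kn|k kn]; [apply: ma|apply: a1|apply: cB]; exact: leqW.
Qed.

Lemma contraction_chainM D mu (a : nat -> R -> R[i]) B n : measurable D ->
  (forall k, (k <= n)%N -> cmeasurable_fun D (a k)) ->
  (forall k x, (k <= n)%N -> D x -> normc (a k x) <= 1)%R ->
  (forall k, (k < n)%N -> contraction D mu D mu (B k)) ->
  contraction D mu D mu (fun u => chain a B n (fun x => a n x * u x)%R).
Proof.
move=> mD ma a1 cB; apply: (@contraction_comp D mu D mu D mu (fun u x => a n x * u x)%R).
  apply: contractionM => //; [exact: ma | by move=> x; exact: a1].
by apply: contraction_chain => // [k kn|k x kn]; [exact/ma/ltnW | exact/a1/ltnW].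
Qed.

Section Unitary.
Variables (DX : set R) (mu : {measure set (measurableTypeR R) -> \bar R})
  (DY : set R) (nu : {measure set (measurableTypeR R) -> \bar R}).
Variables (mDX : measurable DX) (mDY : measurable DY) (F : unitary_op DX mu DY nu).

Lemma L2_innerxx (D : set R) (m : {measure set (measurableTypeR R) -> \bar R}) f :
  complex.Re (L2_inner D m f f) = fine (sqnorm D m f).
Proof.
congr fine; apply: eq_integral => x _; rewrite sqr_normcE; case: (f x) => a b /=.
by rewrite mulrN opprK -!expr2.
Qed.

Lemma sqnorm_ufun f : L2 DX mu f -> sqnorm DY nu (F f) = sqnorm DX mu f.
Proof.
move=> Lf; have := congr1 Re (ufun_inner F Lf Lf); rewrite !L2_innerxx => EF.
have [_ LF] := ufun_L2 F Lf; have [_ Lff] := Lf.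
by rewrite -[LHS]fineK ?EF ?fineK ?ge0_fin_numE ?sqnorm_ge0.
Qed.

Lemma ufunB f f' : L2 DX mu f -> L2 DX mu f' ->
  ae_eq_on DY nu (F (fun x => f' x - f x)%R) (fun y => F f' y - F f y)%R.
Proof.
move=> Lf Lf'; have := ufun_linear F (-1)%R Lf Lf'.
rewrite (_ : (fun x => f' x - f x)%R = (fun x => -1 * f x + f' x)%R); last first.
  by apply/funext => x; rewrite mulN1r addrC.
by apply: aeS => x FE Dx; rewrite FE// mulN1r addrC.
Qed.

Lemma sqnorm_ufunB f f' : L2 DX mu f -> L2 DX mu f' ->
  sqnorm DY nu (fun y => F f' y - F f y)%R = sqnorm DX mu (fun x => f' x - f x)%R.
Proof.
move=> Lf Lf'; rewrite -sqnorm_ufun; last exact: L2B.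
have LFf := ufun_L2 F Lf; have LFf' := ufun_L2 F Lf'.
have [mB _] := L2B mDY LFf' LFf; have [mF _] := ufun_L2 F (L2B mDX Lf' Lf).
by apply/esym/ae_sqnorm => //; exact: ufunB.
Qed.

Lemma contraction_ufun : contraction DX mu DY nu F.
Proof.
by split=> [f|f f' Lf Lf']; [exact: ufun_L2 | rewrite sqnorm_ufunB].
Qed.

(** The isometry of [F] is applied to [uinv F g] and [uinv F g'], whose images are [g] and [g']
    almost everywhere by [uinvK]. *)
Lemma contraction_uinv : contraction DY nu DX mu (uinv F).
Proof.
split=> [g|g g' Lg Lg']; first exact: uinv_L2.
have Lig := uinv_L2 F Lg; have Lig' := uinv_L2 F Lg'.
rewrite -sqnorm_ufunB// le_eqVlt; apply/orP; left; apply/eqP.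
have [m1 _] := L2B mDY (ufun_L2 F Lig') (ufun_L2 F Lig); have [m2 _] := L2B mDY Lg' Lg.
apply: ae_sqnorm => //; apply: aeS2 (uinvK F Lg) (uinvK F Lg') => y E E' Dy.
by rewrite E// E'.
Qed.

End Unitary.

End L2Theory.

(** * Weighted L^2 spaces and extension from bounded functions *)

Section Extension.
Context {R : realType}.
Local Notation normc := (@ComplexField.Normc.normc R).
Local Open Scope ereal_scope.
Variables (D : set R) (mD : measurable D)
  (mu : {measure set (measurableTypeR R) -> \bar R}).

Lemma measurable_funV (h : R -> R) : measurable_fun D h ->
  (forall x, D x -> (0 < h x)%R) -> measurable_fun D (fun x => (h x)^-1)%R.
Proof.
move=> mh h0; apply: (eq_measurable_fun (fun x => h x `^ (-1))%R).
  by move=> x; rewrite inE => Dx; rewrite powR_inv1// ltW ?h0.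
exact: (measurableT_comp (@measurable_powR R (-1)) mh).
Qed.

Lemma rmulcVK (h : R -> R) (f : R -> R[i]) x : (0 < h x)%R ->
  rmulc h (rmulc (fun x => (h x)^-1)%R f) x = f x.
Proof.
by move=> h0; rewrite /rmulc mulrA -rmorphM /= mulfV ?mul1r// gt_eqF.
Qed.

Lemma rmulcKV (h : R -> R) (f : R -> R[i]) x : (0 < h x)%R ->
  rmulc (fun x => (h x)^-1)%R (rmulc h f) x = f x.
Proof.
by move=> h0; rewrite /rmulc mulrA -rmorphM /= mulVf ?mul1r// gt_eqF.
Qed.

Lemma eq_cmeasurable (f g : R -> R[i]) : (forall x, D x -> f x = g x) ->
  cmeasurable_fun D f -> cmeasurable_fun D g.
Proof.
move=> fg [fR fI]; split.
  by apply: eq_measurable_fun fR => x; rewrite inE => Dx; rewrite fg.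
by apply: eq_measurable_fun fI => x; rewrite inE => Dx; rewrite fg.
Qed.

Lemma eq_sqnorm (f g : R -> R[i]) : (forall x, D x -> f x = g x) ->
  sqnorm D mu f = sqnorm D mu g.
Proof. by move=> fg; apply: eq_integral => x; rewrite inE => Dx; rewrite fg. Qed.

Lemma eq_L2 (f g : R -> R[i]) : (forall x, D x -> f x = g x) ->
  L2 D mu f -> L2 D mu g.
Proof.
move=> fg [mf foo]; split; first exact: eq_cmeasurable mf.
by rewrite -/(sqnorm _ _ _) -(eq_sqnorm fg).
Qed.

(** Multiplication by [h] identifies the weighted space with L^2(mu). Positivity of [h] allows
    dividing by it to recover the measurability of [f]. *)
Lemma L2wP (h : R -> R) (f : R -> R[i]) : measurable_fun D h ->
  (forall x, D x -> (0 < h x)%R) ->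
  L2w D mu (fun x => h x ^+ 2)%R f <-> L2 D mu (rmulc h f).
Proof.
move=> mh h0; rewrite /L2w /L2 sqnorm_wE -/(sqnorm _ _ _).
split=> -[mf foo]; split=> //; first exact: cmeasurable_rmulc.
apply: (@eq_cmeasurable (rmulc (fun x => (h x)^-1)%R (rmulc h f))).
  by move=> x Dx; rewrite rmulcKV ?h0.
by apply: cmeasurable_rmulc => //; exact: measurable_funV.
Qed.

(** The approximants are [f] cut off to the sets where |f|^2 <= m. Their weighted distance to [f]
    tends to 0 by dominated convergence, with |h f|^2 as the dominating function. *)
Lemma dense_bounded (h : R -> R) (f : R -> R[i]) (e : R) : measurable_fun D h ->
  L2w D mu (fun x => h x ^+ 2)%R f -> (0 < e)%R ->
  exists f', [/\ cbounded_on D f', L2w D mu (fun x => h x ^+ 2)%R f' &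
    sqnorm_w D mu (fun x => h x ^+ 2)%R (fun x => f' x - f x)%R < e%:E].
Proof.
move=> mh [mf foo] e0; rewrite sqnorm_wE in foo.
have mq : measurable_fun D (fun x => normc (f x) ^+ 2)%R.
  exact: (measurable_EFinP _ _).1 (measurable_sqnormc mf).
pose A (m : nat) : set R := D `&` (fun x => normc (f x) ^+ 2)%R @^-1` `]-oo, m%:R%R].
have mA m : measurable (A m) by apply: mq => //; exact: measurable_itv.
pose f_ m : R -> R[i] := rmulc (\1_(A m) : R -> R) f.
have mf_ m : cmeasurable_fun D (f_ m).
  by apply: cmeasurable_rmulc => //; exact: measurable_indic.
have mhf : cmeasurable_fun D (rmulc h f) by exact: cmeasurable_rmulc.
have f_in m x : A m x -> f_ m x = f x.
  by move=> Ax; rewrite /f_ /rmulc indicE mem_set// mul1r.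
have f_notin m x : ~ A m x -> f_ m x = 0%R.
  by move=> Ax; rewrite /f_ /rmulc indicE memNset// mul0r.
have cvg0 : sqnorm D mu (rmulc h (fun x => f_ m x - f x)%R) @[m --> \oo] --> 0.
  rewrite (_ : 0 = \int[mu]_(x in D) (cst 0 x)); last by rewrite integral0.
  apply: (@dominated_cvg _ (measurableTypeR R) R mu D mD _ _
    (fun x => (normc (rmulc h f x) ^+ 2)%:E)) => //.
  - move=> m; apply: measurable_sqnormc; apply: cmeasurable_rmulc => //.
    exact: cmeasurableB.
  - move=> x Dx; apply: cvg_near_cst.
    exists (Num.truncn (normc (f x) ^+ 2)).+1 => // m /= xm.
    rewrite /rmulc f_in ?subrr ?mulr0 ?ComplexField.Normc.normc0 ?expr0n//.
    split=> //=; rewrite in_itv /= ltW// (lt_le_trans (truncnS_gt _))// ler_nat//.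
  - apply/integrableP; split; first exact: measurable_sqnormc.
    under eq_integral do rewrite gee0_abs ?lee_fin ?sqr_ge0//.
    exact: foo.
  - move=> m x Dx; rewrite gee0_abs ?lee_fin ?sqr_ge0//.
    have [Ax|Ax] := pselect (A m x).
      rewrite /rmulc f_in// subrr mulr0 ComplexField.Normc.normc0 expr0n//=.
      exact: sqr_ge0.
    rewrite /rmulc f_notin// sub0r mulrN !sqr_normcE.
    by case: (_ * _)%R => ? ? /=; rewrite !sqrrN.
have /cvg0 [N _ fN] : nbhs (0 : \bar R) [set y | y < e%:E].
  by apply: open_ereal_lt'; rewrite lte_fin.
exists (f_ N); split.
(* From u^2 <= N follows u <= N + 1, without a square root. *)
- exists (N%:R + 1)%R => x Dx; have [Ax|Ax] := pselect (A N x); last first.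
    by rewrite f_notin// ComplexField.Normc.normc0.
  rewrite f_in//; case: Ax => _ /=; rewrite in_itv /=.
  have := normc_ge0 (f x); have : (0 <= N%:R :> R)%R by [].
  move: (normc (f x)) (N%:R : R)%R => u v; nra.
- split=> //; rewrite sqnorm_wE; apply: le_lt_trans foo.
  apply: le_sqnorm => //; first exact: cmeasurable_rmulc.
  move=> x Dx; have [Ax|Ax] := pselect (A N x); first by rewrite /rmulc f_in.
  by rewrite {1}/rmulc f_notin// mulr0 ComplexField.Normc.normc0 normc_ge0.
- by rewrite sqnorm_wE; apply: fN => /=.
Qed.

(** Both extensions are close to their values at a nearby bounded [f'], where both agree with [A]
    almost everywhere. *)
Lemma continuous_extension_unique (h1 h0 : R -> R) A E1 E2 f :
  measurable_fun D h1 -> measurable_fun D h0 -> (forall x, D x -> (0 < h0 x)%R) ->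
  continuous_extension D mu (fun x => h1 x ^+ 2)%R (fun x => h0 x ^+ 2)%R A E1 ->
  continuous_extension D mu (fun x => h1 x ^+ 2)%R (fun x => h0 x ^+ 2)%R A E2 ->
  L2w D mu (fun x => h1 x ^+ 2)%R f -> ae_eq_on D mu (E1 f) (E2 f).
Proof.
move=> mh1 mh0 h0_gt0 ext1 ext2 Lf.
have [mE1 _] := ext_L2w ext1 Lf; have [mE2 _] := ext_L2w ext2 Lf.
have mr g : cmeasurable_fun D g -> cmeasurable_fun D (rmulc h0 g).
  exact: cmeasurable_rmulc.
suff : ae_eq_on D mu (rmulc h0 (E1 f)) (rmulc h0 (E2 f)).
  apply: aeS => x E12 Dx; have h0x := h0_gt0 _ Dx.
  by rewrite -(rmulcKV (E1 f) h0x) -(rmulcKV (E2 f) h0x) /rmulc -!/(rmulc _ _ _) E12.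
apply: sqnorm_eq0 => //; [exact: mr..|].
apply/eqP; rewrite eq_le sqnorm_ge0 andbT; apply/lee_addgt0Pr => e e0.
(* Two errors below e/4, each doubled by [sqnormD_le], add up to e. *)
rewrite add0e; have e4 : (0 < e / 4)%R by rewrite divr_gt0.
have [d1 d1_gt0 cont1] := ext_continuous ext1 Lf e4.
have [d2 d2_gt0 cont2] := ext_continuous ext2 Lf e4.
have d12 : (0 < Num.min d1 d2)%R by rewrite lt_min d1_gt0.
have [f' [bf' Lf' ff']] := dense_bounded mh1 Lf d12.
have {}cont1 := cont1 f' Lf' (lt_le_trans ff' _).
have {}cont2 := cont2 f' Lf' (lt_le_trans ff' _).
have := cont1; rewrite lee_fin ge_min lexx => /(_ isT) {}cont1.
have := cont2; rewrite lee_fin ge_min lexx orbT => /(_ isT) {}cont2.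
have E12 : ae_eq_on D mu (E1 f') (E2 f').
  by apply: aeS2 (ext_eq ext1 bf' Lf') (ext_eq ext2 bf' Lf') => x + + Dx => -> // ->.
have [mE1' _] := ext_L2w ext1 Lf'; have [mE2' _] := ext_L2w ext2 Lf'.
(* As E1 f' = E2 f' almost everywhere, E1 f - E2 f = (E2 f' - E2 f) - (E1 f' - E1 f). *)
rewrite -rmulcB (@ae_sqnorm _ _ mD mu _ (fun x =>
    rmulc h0 (fun x => E2 f' x - E2 f x)%R x + - rmulc h0 (fun x => E1 f' x - E1 f x)%R x)%R).
- apply: le_trans (sqnormD_le _ _ _ _) _ => //.
  + by apply: mr; exact: cmeasurableB.
  + by apply: cmeasurableN; apply: mr; exact: cmeasurableB.
  rewrite sqnormN -!sqnorm_wE; move/ltW: cont1; move/ltW: cont2.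
  rewrite -(lee_pmul2l (x := 2%:E))// => c2; rewrite -(lee_pmul2l (x := 2%:E))// => c1.
  apply: le_trans (leeD c2 c1) _; rewrite -!EFinM -EFinD lee_fin; lra.
- by apply: mr; exact: cmeasurableB.
- by apply: cmeasurableD; [|apply: cmeasurableN]; apply: mr; exact: cmeasurableB.
- by apply: aeS E12 => x E12 Dx; rewrite /rmulc E12//; ring.
Qed.

(** * The product formula for a single process, with weights [H k] and step operators [B k] *)

Variables (S : set R) (d : measure_display) (Om : measurableType d).
Variable Z : markov_process S D Om.
Variables (n : nat) (r : nat -> R) (H : nat -> R -> R) (a : nat -> R -> R[i])
  (B : nat -> (R -> R[i]) -> (R -> R[i])).
Hypothesis r_S : forall k, (k <= n)%N -> S (r k).
Hypothesis r_incr : forall k, (k < n)%N -> (r k < r k.+1)%R.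
Hypothesis mH : forall k, (k <= n)%N -> measurable_fun D (H k).
Hypothesis H_gt0 : forall k x, (k <= n)%N -> D x -> (0 < H k x)%R.
Hypothesis ma : forall k, (k <= n)%N -> cmeasurable_fun D (a k).
Hypothesis a_le1 : forall k x, (k <= n)%N -> D x -> (normc (a k x) <= 1)%R.
Hypothesis B_contraction : forall k, (k < n)%N -> contraction D mu D mu (B k).
Hypothesis semigroupB : forall k f, (k < n)%N -> cbounded_on D f ->
  L2w D mu (fun x => H k.+1 x ^+ 2)%R f ->
  ae_eq_on D mu (semigroup Z (r k) (r k.+1) f)
    (fun x => ((H k x)^-1)%:C * B k (rmulc (H k.+1) f) x)%R.

Let cma k : (k <= n)%N -> cmbounded D (a k).
Proof.
move=> kn; apply/cmboundedP; split; first exact: ma.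
by exists 1%R => x; exact: a_le1.
Qed.

(** The weights telescope: the factor 1/H_k left by one step cancels against the H_k required by the
    next. [g] below stays bounded, so the step formula applies again, and the null set of each step
    passes through the shorter chain by [contraction_ae]. *)
Lemma chain_semigroup (f : R -> R[i]) : cbounded_on D f ->
  L2w D mu (fun x => H n x ^+ 2)%R f ->
  ae_eq_on D mu (rmulc (H 0%N) (chain a (fun k => semigroup Z (r k) (r k.+1)) n f))
    (chain a B n (rmulc (H n) f)).
Proof.
suff chain_le m : (m <= n)%N -> forall f, cbounded_on D f ->
    L2w D mu (fun x => H m x ^+ 2)%R f ->
    ae_eq_on D mu (rmulc (H 0%N) (chain a (fun k => semigroup Z (r k) (r k.+1)) m f))
      (chain a B m (rmulc (H m) f)) by exact: chain_le.
elim: m => [_ {}f _ _|m IH mn {}f bf Lf] /=.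
  exact: (@aeW _ (measurableTypeR R)).
set g := (fun x => a m x * semigroup Z (r m) (r m.+1) f x)%R.
have mn' := ltnW mn.
have Hm0 x : D x -> (0 < H m x)%R by exact: H_gt0.
have Hm1 x : D x -> (0 < H m.+1 x)%R by exact: H_gt0.
have bg : cmbounded D g.
  apply: cmboundedM; first exact: cma.
  apply: cmbounded_semigroup => //; [exact: r_S|exact: r_S|exact/ltW/r_incr|].
  by apply/cmboundedP; split => //; case: Lf.
have [mg bbg] := (cmboundedP D g).1 bg.
have [BL _] := B_contraction mn.
have LB : L2 D mu (fun x => a m x * B m (rmulc (H m.+1) f) x)%R.
  apply: L2M => //; [exact: ma | by move=> x; exact: a_le1 |].
  by apply: BL; apply/L2wP => //; exact: mH.
have gB : ae_eq_on D mu (rmulc (H m) g) (fun x => a m x * B m (rmulc (H m.+1) f) x)%R.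
  apply: aeS (semigroupB mn bf Lf) => x sgB Dx.
  rewrite /g /rmulc sgB// mulrCA; congr (_ * _)%R.
  by rewrite mulrA -rmorphM /= mulfV ?mul1r// gt_eqF ?Hm0.
have Lg : L2 D mu (rmulc (H m) g).
  by apply: L2_ae gB LB => //; apply: cmeasurable_rmulc => //; exact: mH.
have Lg2 : L2w D mu (fun x => H m x ^+ 2)%R g by apply/L2wP => //; exact: mH.
have cm : contraction D mu D mu (chain a B m).
  by apply: contraction_chain => // [k|k x|k] /ltn_trans/(_ mn) kn;
    [exact/ma/ltnW | exact/a_le1/ltnW | exact: B_contraction].
apply: aeS2 (IH mn' g bbg Lg2) (contraction_ae mD mD cm Lg LB gB) => x E1 E2 Dx.
by rewrite E1// E2.
Qed.

Let Phi u := chain a B n (fun x => a n x * u x)%R.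

Let Phi_contraction : contraction D mu D mu Phi.
Proof. exact: contraction_chainM. Qed.

Let expect := cond_expect Z (r 0%N) (r n)
  (fun w => \prod_(k < n.+1) a k (pos Z (r k) w))%R.

Let is_ext := continuous_extension D mu
  (fun x => H n x ^+ 2)%R (fun x => H 0%N x ^+ 2)%R expect.

(** An explicit continuous extension, the contraction [Phi] conjugated by the weights. It witnesses
    existence, and by uniqueness it computes every other extension. *)
Definition chain_ext (f : R -> R[i]) : R -> R[i] :=
  rmulc (fun x => (H 0%N x)^-1)%R (chain a B n (fun x => a n x * rmulc (H n) f x)%R).

Let mH0 : measurable_fun D (H 0%N). Proof. exact: mH. Qed.
Let H0_gt0 x : D x -> (0 < H 0%N x)%R. Proof. exact: H_gt0. Qed.
Let mHn : measurable_fun D (H n). Proof. exact: mH. Qed.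
Let Hn_gt0 x : D x -> (0 < H n x)%R. Proof. exact: H_gt0. Qed.

Let chain_extE f x : D x -> rmulc (H 0%N) (chain_ext f) x = Phi (rmulc (H n) f) x.
Proof. by move=> Dx; rewrite rmulcVK// H0_gt0. Qed.

Lemma chain_extP : is_ext chain_ext.
Proof.
have [PL Pc] := Phi_contraction.
have LPhi f : L2w D mu (fun x => H n x ^+ 2)%R f -> L2 D mu (rmulc (H n) f).
  by move=> Lf; apply/L2wP.
split=> [f Lf|f bf Lf|f Lf e e0].
- apply/L2wP => //; apply: (@eq_L2 (Phi (rmulc (H n) f))).
    by move=> x Dx; rewrite chain_extE.
  exact/PL/LPhi.
(* The functional has n + 1 factors but only n time steps; the factor at the final time is absorbed
   into the function evaluated there. *)
- pose g x := (a n x * f x)%R.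
  have /cmboundedP[_ bg] : cmbounded D g.
    apply: cmboundedM; first exact: cma.
    by apply/cmboundedP; split => //; case: Lf.
  have gE : rmulc (H n) g = (fun x => a n x * rmulc (H n) f x)%R.
    by apply/funext => x; rewrite /rmulc /g mulrCA.
  have Lg : L2w D mu (fun x => H n x ^+ 2)%R g.
    apply/L2wP => //; rewrite gE.
    by apply: L2M; [exact: mD|exact: ma|move=> x; exact: a_le1|exact: LPhi].
  apply: aeS (chain_semigroup bg Lg) => x E Dx.
  have -> : expect f x = chain a (fun k => semigroup Z (r k) (r k.+1)) n g x.
    rewrite -(cond_expect_prod Z mD)//; last 2 first.
    + by move=> k kn; exact/cma/ltnW.
    + by apply/cmboundedP; split => //; case: Lg.
    apply: eq_cond_expect; first exact: r_S.
    by move=> w _; rewrite big_ord_recr /= /g mulrA.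
  rewrite -(rmulcKV (chain _ _ n g) (H0_gt0 Dx)) /chain_ext -gE.
  by congr (_ * _)%R; rewrite -E.
(* The modulus of continuity is the identity, [Phi] being a contraction between the weighted
   functions. *)
- exists e => // f' Lf'; rewrite !sqnorm_wE !rmulcB; apply: le_lt_trans.
  rewrite (@eq_sqnorm _ (fun x => Phi (rmulc (H n) f') x - Phi (rmulc (H n) f) x)%R).
    exact: Pc (LPhi _ Lf) (LPhi _ Lf').
  by move=> x Dx; rewrite !chain_extE.
Qed.

Lemma continuous_extensionE E f : is_ext E -> L2w D mu (fun x => H n x ^+ 2)%R f ->
  L2 D mu (rmulc (H 0%N) (E f)) /\
  ae_eq_on D mu (rmulc (H 0%N) (E f)) (chain a B n (fun x => a n x * rmulc (H n) f x)%R).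
Proof.
move=> extE Lf; split; first by apply/L2wP => //; exact: ext_L2w extE _ Lf.
apply: aeS (continuous_extension_unique mHn mH0 H0_gt0 extE chain_extP Lf) => x EE Dx.
by rewrite /rmulc EE//; exact: chain_extE.
Qed.

End Extension.

(** * The two dual products *)

Section ComplexExponential.
Context {R : realType}.
Local Notation normc := (@ComplexField.Normc.normc R).

Lemma cexpD (z w : R[i]) : cexp (z + w) = cexp z * cexp w.
Proof.
case: z w => [a b] [c e]; rewrite /cexp /= expRD cosD sinD.
by apply/eqP; rewrite eq_complex /=; apply/andP; split; apply/eqP; ring.
Qed.

Lemma cexp0 : cexp (0 : R[i]) = 1.
Proof. by rewrite /cexp /= expR0 cos0 sin0 mulr1 mulr0. Qed.

Lemma cexp_sum n (z : nat -> R[i]) : cexp (\sum_(k < n) z k) = \prod_(k < n) cexp (z k).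
Proof.
elim: n => [|n IH]; first by rewrite !big_ord0 cexp0.
by rewrite !big_ord_recr /= cexpD IH.
Qed.

Lemma normc_cexp (z : R[i]) : normc (cexp z) = expR (complex.Re z).
Proof.
by rewrite /cexp /= !exprMn -mulrDr cos2Dsin2 mulr1 sqrtr_sqr ger0_norm// expR_ge0.
Qed.

Definition damp (c : R) (psi : R -> R[i]) (x : R) : R[i] := cexp (c%:C * psi x).

(** Since |e^z| = e^(Re z), this is where values in the right half-plane enter; [c] will be minus a
    time increment. *)
Lemma normc_damp_le1 (D : set R) (c : R) (psi : R -> R[i]) x :
  c <= 0 -> (forall x, D x -> 0 <= complex.Re (psi x)) -> D x ->
  normc (damp c psi x) <= 1.
Proof.
move=> c0 psi0 Dx; rewrite normc_cexp -expR0 ler_expR ReM /= mul0r subr0.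
by rewrite mulr_le0_ge0// psi0.
Qed.

Lemma cmeasurable_cexp (D : set R) (f : R -> R[i]) :
  cmeasurable_fun D f -> cmeasurable_fun D (fun x => cexp (f x)).
Proof.
move=> [fR fI]; split => /=; apply: measurable_funM.
- exact: (measurableT_comp (@measurable_expR R)).
- by apply: measurableT_comp fI; apply: continuous_measurable_fun; exact: continuous_cos.
- exact: (measurableT_comp (@measurable_expR R)).
- by apply: measurableT_comp fI; apply: continuous_measurable_fun; exact: continuous_sin.
Qed.

Lemma cmeasurable_damp (D : set R) c psi :
  cmeasurable_fun D psi -> cmeasurable_fun D (damp c psi).
Proof.
by move=> mpsi; apply: cmeasurable_cexp; apply: cmeasurableM.
Qed.

(** [p] stands for the real or imaginary part: additive and 1-Lipschitz for the modulus, hence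
    continuous, so that [p] after [psi] is continuous on [D] and thus measurable. *)
Lemma ccontinuous_comp (D : set R) (psi : R -> R[i]) (p : R[i] -> R) :
  {morph p : x y / x - y} -> (forall z, (`|p z|%:C <= `|z|)) ->
  measurable D -> ccontinuous_on D psi -> measurable_fun D (fun x => p (psi x)).
Proof.
move=> pB p_le mD cpsi; apply: subspace_continuous_measurable_fun => //.
move=> x; apply: (@continuous_comp (subspace D) (R[i] : numFieldType) R psi p); first exact: cpsi.
move=> A /nbhs_ballP[e /= e0 eA]; apply/nbhs_ballP; exists e%:C => /=; first by rewrite ltcR.
move=> w /= zw; apply: eA; rewrite -ball_normE /= -pB -ltcR.
exact: le_lt_trans (p_le _) zw.
Qed.

Lemma ccontinuous_measurable (D : set R) (psi : R -> R[i]) :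
  measurable D -> ccontinuous_on D psi -> cmeasurable_fun D psi.
Proof.
move=> mD cpsi; split; apply: ccontinuous_comp => //.
- by move=> [? ?] [? ?].
- exact: normc_ge_Re.
- by move=> [? ?] [? ?].
- move=> z; rewrite normc_def lecR -sqrtr_sqr ler_sqrt ?addr_ge0 ?sqr_ge0//.
  by rewrite lerDr sqr_ge0.
Qed.

Lemma measurable_state_space (D : set R) : state_space D -> measurable D.
Proof.
move=> [|cD]; first exact: is_interval_measurable.
by exact: countable_measurable.
Qed.

End ComplexExponential.

(** Both sides are the same alternating word in [F], [uinv F] and the weights, bracketed
    differently. The left one starts with the weight [aY 0], which must be 1 for the words to agree.
    The equality is exact, not merely almost everywhere. *)
Lemma chain_ufun {R : realType} (DX : set R)
    (mu : {measure set (measurableTypeR R) -> \bar R}) (DY : set R)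
    (nu : {measure set (measurableTypeR R) -> \bar R}) (F : unitary_op DX mu DY nu)
    (aX aY : nat -> R -> R[i]) n u :
  aY 0%N = cst 1 ->
  chain aY (fun k g => F (fun x => aX k x * uinv F g x)) n (fun y => aY n y * F u y) =
  F (chain aX (fun k f => uinv F (fun y => aY k.+1 y * F f y)) n u).
Proof.
move=> aY0; elim: n u => [|n IH] u /=; last by rewrite -IH.
by rewrite aY0; apply/funext => y; rewrite mul1r.
Qed.

Theorem theorem2p1 (R : realType) (S T DX DY : set R)
    (hS : time_interval S) (hT : time_interval T)
    (hDX : state_space DX) (hDY : state_space DY)
    (dX : measure_display) (OmX : measurableType dX) (X : markov_process S DX OmX)
    (dY : measure_display) (OmY : measurableType dY) (Y : markov_process T DY OmY)
    (mu nu : {measure set (measurableTypeR R) -> \bar R})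
    (F : unitary_op DX mu DY nu) (phi psi : R -> R[i]) (h j : R -> R -> R)
    (hA : assumption_A X Y F phi psi h j)
    (n : nat) (hn : (1 <= n)%N) (s t : nat -> R)
    (hs : forall k, (k <= n)%N -> S (s k)) (ht : forall k, (k <= n)%N -> T (t k))
    (s_incr : forall k, (k < n)%N -> s k < s k.+1)
    (t_incr : forall k, (k < n)%N -> t k < t k.+1)
    (f g : R -> R[i])
    (hf : L2 DX mu (rmulc (h (s n)) f))
    (hfg : L2_eq DY nu (rmulc (j (t n)) g) (F (rmulc (h (s n)) f))) :
  let xi := fun w : OmX =>
    cexp (- \sum_(k < n) (t k.+1 - t k)%:C * psi (pos X (s k) w)) in
  let zeta := fun w : OmY =>
    cexp (- \sum_(k < n) (s k.+1 - s k)%:C * phi (pos Y (t k.+1) w)) in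
  let is_extX := continuous_extension DX mu
    (fun x => h (s n) x ^+ 2) (fun x => h (s 0%N) x ^+ 2)
    (cond_expect X (s 0%N) (s n) xi) in
  let is_extY := continuous_extension DY nu
    (fun y => j (t n) y ^+ 2) (fun y => j (t 0%N) y ^+ 2)
    (cond_expect Y (t 0%N) (t n) zeta) in
  [/\ exists EX, is_extX EX,
      exists EY, is_extY EY &
      forall EX EY, is_extX EX -> is_extY EY ->
        let FF := EX f in
        let GG := EY g in
        L2 DX mu (rmulc (h (s 0%N)) FF) /\
        L2_eq DY nu (rmulc (j (t 0%N)) GG) (F (rmulc (h (s 0%N)) FF))].
Proof.
have mDX := measurable_state_space hDX; have mDY := measurable_state_space hDY.
have mphi := ccontinuous_measurable mDY (phi_continuous hA).
have mpsi := ccontinuous_measurable mDX (psi_continuous hA).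
(* X is weighted at s_0, ..., s_(n-1) and Y at t_1, ..., t_n; a trivial factor at
   one end makes both functionals products over 0, ..., n. *)
pose aX k := if (k < n)%N then damp (t k - t k.+1) psi else cst 1.
pose aY k := if k is m.+1 then damp (s m - s m.+1) phi else cst 1.
pose BX k (f : R -> R[i]) := uinv F (fun y => aY k.+1 y * F f y).
pose BY k (g : R -> R[i]) := F (fun x => aX k x * uinv F g x).
have maX k : cmeasurable_fun DX (aX k).
  by rewrite /aX; case: ifP => _; [exact: cmeasurable_damp | exact: cmeasurable_cst].
have maY k : cmeasurable_fun DY (aY k).
  by case: k => [|k]; [exact: cmeasurable_cst | exact: cmeasurable_damp].
have aX1 k x : DX x -> ComplexField.Normc.normc (aX k x) <= 1.
  move=> Dx; rewrite /aX; case: ifP => kn; last by rewrite ComplexField.Normc.normc1.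
  by apply: normc_damp_le1 (psi_ge0 hA) Dx; rewrite subr_le0 ltW ?t_incr.
have aY1 k y : (k <= n)%N -> DY y -> ComplexField.Normc.normc (aY k y) <= 1.
  case: k => [|k] kn Dy; first by rewrite ComplexField.Normc.normc1.
  by apply: normc_damp_le1 (phi_ge0 hA) Dy; rewrite subr_le0 ltW ?s_incr.
have cF := contraction_ufun mDX mDY F; have cV := contraction_uinv mDX mDY F.
have cBX k : (k < n)%N -> contraction DX mu DX mu (BX k).
  move=> kn; apply: (@contraction_comp _ DX mu DY nu DX mu) cV.
  by apply: contractionM => // y; exact: aY1.
have cBY k : (k < n)%N -> contraction DY nu DY nu (BY k).
  move=> kn; apply: (@contraction_comp _ DY nu DX mu DY nu) cF.
  by apply: contractionM => // x; exact: aX1.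
have mh k : (k <= n)%N -> measurable_fun DX (h (s k)).
  by move=> /hs; exact: h_measurable hA _.
have mj k : (k <= n)%N -> measurable_fun DY (j (t k)).
  by move=> /ht; exact: j_measurable hA _.
have h0 k x : (k <= n)%N -> DX x -> 0 < h (s k) x.
  by move=> /hs Ss Dx; exact: (h_gt0 hA).
have j0 k y : (k <= n)%N -> DY y -> 0 < j (t k) y.
  by move=> /ht Tt Dy; exact: (j_gt0 hA).
have sgX k f' : (k < n)%N -> cbounded_on DX f' ->
    L2w DX mu (fun x => h (s k.+1) x ^+ 2) f' ->
    ae_eq_on DX mu (semigroup X (s k) (s k.+1) f')
      (fun x => ((h (s k) x)^-1)%:C * BX k (rmulc (h (s k.+1)) f') x).
  by move=> kn; apply: (semigroupX hA); [exact/hs/ltnW | exact: hs | exact: s_incr].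
have sgY k g' : (k < n)%N -> cbounded_on DY g' ->
    L2w DY nu (fun y => j (t k.+1) y ^+ 2) g' ->
    ae_eq_on DY nu (semigroup Y (t k) (t k.+1) g')
      (fun y => ((j (t k) y)^-1)%:C * BY k (rmulc (j (t k.+1)) g') y).
  move=> kn; rewrite /BY /aX kn.
  by apply: (semigroupY hA); [exact/ht/ltnW | exact: ht | exact: t_incr].
move=> xi zeta is_extX is_extY.
have xiE : xi = fun w => \prod_(k < n.+1) aX k (pos X (s k) w).
  apply/funext => w; rewrite big_ord_recr /= {2}/aX ltnn mulr1 /xi -sumrN.
  rewrite (eq_bigr (fun k : 'I_n => (t k - t k.+1)%:C * psi (pos X (s k) w))).
    rewrite (cexp_sum _ (fun k => (t k - t k.+1)%:C * psi (pos X (s k) w))).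
    by apply: eq_bigr => k _; rewrite /aX ltn_ord.
  by move=> k _; rewrite -mulNr -rmorphN opprB.
have zetaE : zeta = fun w => \prod_(k < n.+1) aY k (pos Y (t k) w).
  apply/funext => w; rewrite big_ord_recl /= mul1r /zeta -sumrN.
  rewrite (eq_bigr (fun k : 'I_n => (s k - s k.+1)%:C * phi (pos Y (t k.+1) w))).
    exact: (cexp_sum _ (fun k => (s k - s k.+1)%:C * phi (pos Y (t k.+1) w))).
  by move=> k _; rewrite -mulNr -rmorphN opprB.
have extX := @chain_extP _ DX mDX mu S dX OmX X n s (fun k => h (s k)) aX BX
  hs s_incr mh h0 (fun k _ => maX k) (fun k x _ => @aX1 k x) cBX sgX.
have extY := @chain_extP _ DY mDY nu T dY OmY Y n t (fun k => j (t k)) aY BY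
  ht t_incr mj j0 (fun k _ => maY k) aY1 cBY sgY.
rewrite -xiE in extX; rewrite -zetaE in extY.
split.
- by exists (chain_ext n (fun k => h (s k)) aX BX).
- by exists (chain_ext n (fun k => j (t k)) aY BY).
move=> EX EY hEX hEY FF GG.
rewrite /is_extX xiE in hEX; rewrite /is_extY zetaE in hEY.
have Lf : L2w DX mu (fun x => h (s n) x ^+ 2) f.
  by apply/L2wP => //; [exact: mh | move=> x; exact: h0].
have Lg : L2w DY nu (fun y => j (t n) y ^+ 2) g.
  by apply/L2wP => //; [exact: mj | move=> y; exact: j0 | case: hfg].
have [LFF FFE] := @continuous_extensionE _ DX mDX mu S dX OmX X n s (fun k => h (s k))
  aX BX hs s_incr mh h0 (fun k _ => maX k) (fun k x _ => @aX1 k x) cBX sgX _ _ hEX Lf.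
have [LGG GGE] := @continuous_extensionE _ DY mDY nu T dY OmY Y n t (fun k => j (t k))
  aY BY ht t_incr mj j0 (fun k _ => maY k) aY1 cBY sgY _ _ hEY Lg.
have aXn : (fun x => aX n x * rmulc (h (s n)) f x) = rmulc (h (s n)) f.
  by apply/funext => x; rewrite /aX ltnn mul1r.
rewrite aXn in FFE.
have cX : contraction DX mu DX mu (chain aX BX n).
  by apply: contraction_chain => // k x _; exact: aX1.
have cY := contraction_chainM mDY (fun k _ => maY k) aY1 cBY.
have [Ljg LFhf jgE] := hfg.
(* The Y-product is applied to [j g], which equals [F] of [h f] only almost everywhere. Its
   contraction property permits the replacement, after which regrouping turns it into [F] of the
   X-product. *)
have GE := contraction_ae mDY mDY cY Ljg LFhf jgE; rewrite chain_ufun// in GE.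
have FE := contraction_ae mDX mDY cF LFF (cX.1 _ hf) FFE.
split=> //; split=> //; first exact: ufun_L2.
apply: ae_eq_on_trans GGE (ae_eq_on_trans GE _).
by apply: aeS FE => y FE Dy; rewrite FE.
Qed.
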